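(* Let $d\ge 2$, $\epsilon\in(0,1]$ and $\sigma\le \frac{\epsilon}{6\sqrt d}$. For every positive integer $k$ there exists a function $\mathcal{F}^\sigma_k:\mathcal{U}(d)\to\mathbb{R}$ with the following properties. (1) Normalisation: $\int_{\mathcal{U}(d)} \mathrm{d}\mu(\mathcal{U})\,\mathcal{F}^\sigma_k(\mathcal{U})=1$. (2) If $k\ge 5\frac{d^{3/2}}{\sigma}\sqrt{\frac18\frac{\epsilon^2}{d^2\sigma^2}+\log\frac1\sigma}$, then $\int_{B(\mathcal{I},\epsilon)^c}\mathrm{d}\mu(\mathcal{U})\,|\mathcal{F}^\sigma_k(\mathcal{U})|\le 9\exp\!\left(-\frac{\epsilon^2}{4\sigma^2}\right)\left(\frac{\pi}{2}\right)^{d(d-1)}$, where $B(\mathcal{I},\epsilon)^c$ is the complement in $\mathcal{U}(d)$ of the ball of radius $\epsilon$ around the identity channel $\mathcal{I}$. (3) $\mathcal{F}^\sigma_k$ is a balanced polynomial of degree $k$ in $U$ and $\bar U$, i.e. $\mathcal{F}^\sigma_k\in\mathcal{H}_k$. (4) If $k\ge d/\sigma$, then $\|\mathcal{F}^\sigma_k\|_2=\left(\int_{\mathcal{U}(d)}\mathrm{d}\mu(\mathcal{U})|\mathcal{F}^\sigma_k(\mathcal{U})|^2\right)^{1/2}\le 8\cdot 2^{d^2}\sigma^{-d(d-\frac12)}$.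
   Context: $\mathcal{U}(d)$ denotes the set of unitary channels $\mathcal{U}[\rho]=U\rho U^\dagger$ on $\mathbb{C}^d$, $U\in\mathrm{U}(d)$; it is identified with $\mathrm{U}(d)/\mathrm{U}(1)$, and functions on $\mathcal{U}(d)$ are identified with functions on $\mathrm{U}(d)$ invariant under $U\mapsto e^{i\alpha}U$. $\mu$ denotes the normalized Haar measure (on $\mathrm{U}(d)$, and its pushforward on $\mathcal{U}(d)$). The distance on $\mathcal{U}(d)$ is $\mathrm{D}(\mathcal{U},\mathcal{V})=\min_{\varphi\in[0,2\pi)}\|U-e^{i\varphi}V\|_\infty$ (operator norm), and $B(\mathcal{V},r)=\{\mathcal{U}\in\mathcal{U}(d):\mathrm{D}(\mathcal{U},\mathcal{V})\le r\}$. $\mathcal{H}_t$ is the linear span of functions $U\mapsto \mathrm{tr}(A\,U^{\otimes s}\otimes\bar U^{\otimes s})$ with $A$ an operator on $(\mathbb{C}^d)^{\otimes 2s}$ and $0\le s\le t$ (balanced polynomials of degree at most $t$). $\log$ is the natural logarithm. *)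

(* Defs.v *)
From HB Require Import structures.
From mathcomp Require Import all_boot all_order all_algebra.
From mathcomp Require Import complex.
From mathcomp Require Import all_classical all_reals all_analysis.

Set Implicit Arguments.
Unset Strict Implicit.
Unset Printing Implicit Defensive.

Import Order.TTheory GRing.Theory Num.Theory.
Local Open Scope classical_set_scope.
Local Open Scope ring_scope.

Section UnitaryDefs.
Variables (R : realType) (d : nat).

Local Notation C := (complex R).
Local Notation Mx := 'M[C]_d.

Definition cexp (phi : R) : C := Complex (cos phi) (sin phi).

Definition vnorm (x : 'cV[C]_d) : R :=
  Num.sqrt (\sum_(i < d) (complex.Re (x i 0) ^+ 2 + complex.Im (x i 0) ^+ 2)).

Definition opnorm (M : Mx) : R :=
  sup [set vnorm (M *m x) | x in [set x : 'cV[C]_d | vnorm x = 1]].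

(* D(U,V) = min_{phi in [0,2pi)} ||U - e^{i phi} V||_oo (written as inf; the
   minimum is attained) *)
Definition chan_dist (U V : Mx) : R :=
  inf [set opnorm (U - cexp phi *: V) | phi in [set phi : R | 0 <= phi < 2 * pi]].

Definition Ud := {M : Mx | M \is unitarymx}.

Lemma unitarymx1 : (1%:M : Mx) \is unitarymx.
Proof. by apply/unitarymxP; rewrite trmx1 map_scalar_mx rmorph1 mulmx1. Qed.

Definition Ud1 : Ud := exist _ 1%:M unitarymx1.

HB.instance Definition _ := Choice.on Ud.
HB.instance Definition _ := isPointed.Build Ud Ud1.

Definition Ud_mul (V U : Ud) : Ud :=
  exist _ (val V *m val U) (mul_unitarymx (valP V) (valP U)).

(* Borel sigma-algebra of U(d): generated by the real and imaginary parts of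
   the matrix entries (i.e. the Borel sets of the subspace topology of
   U(d) inside C^{d x d} = R^{2 d^2}) *)
Definition Ud_gen : set (set Ud) :=
  [set A | exists (i j : 'I_d) (B : set R), measurable B /\
     (A = [set U : Ud | B (complex.Re (val U i j))] \/
      A = [set U : Ud | B (complex.Im (val U i j))])].

Definition UdM := g_sigma_algebraType Ud_gen.

(* mu is the (normalized) Haar measure of U(d): a left-invariant Borel
   probability measure (unique on the compact group U(d)) *)
Definition is_haar (mu : probability UdM R) : Prop :=
  forall (V : Ud) (A : set UdM), measurable A ->
    mu (Ud_mul V @^-1` A) = mu A.

(* functions on unitary channels = functions on U(d) invariant under phases *)
Definition phase_invariant (f : Ud -> R) : Prop :=
  forall (U W : Ud) (a : R), val W = cexp a *: val U -> f W = f U.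

(* balanced monomials: coefficient * prod_{a<s} U_{i_a j_a} * prod_{b<s} conj(U_{k_b l_b});
   these are exactly the functions U |-> tr(A U^{(x)s} (x) conj(U)^{(x)s}) with
   A a matrix unit (up to scalar), so their span is H_t *)
Record bterm := BTerm {
  bdeg : nat;
  bcoef : C;
  bi : 'I_bdeg -> 'I_d;
  bj : 'I_bdeg -> 'I_d;
  bk : 'I_bdeg -> 'I_d;
  bl : 'I_bdeg -> 'I_d }.

Arguments bi b : clear implicits.
Arguments bj b : clear implicits.
Arguments bk b : clear implicits.
Arguments bl b : clear implicits.

Definition bterm_eval (x : bterm) (U : Mx) : C :=
  bcoef x * (\prod_(a < bdeg x) U (bi x a) (bj x a))
          * (\prod_(b < bdeg x) conjc (U (bk x b) (bl x b))).

Definition in_H (t : nat) (f : Ud -> R) : Prop :=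
  exists ts : seq bterm, all (fun x => (bdeg x <= t)%N) ts /\
    forall U : Ud, (f U)%:C%C = \sum_(x <- ts) bterm_eval x (val U).

End UnitaryDefs.

(* Main.v *)
Require Import Defs.
From HB Require Import structures.
From mathcomp Require Import all_boot all_order all_algebra.
From mathcomp Require Import complex.
From mathcomp Require Import all_classical all_reals all_analysis.
From mathcomp Require Import measurable_realfun.
From mathcomp Require Import zify ring lra.
Set Implicit Arguments.
Unset Strict Implicit.
Unset Printing Implicit Defensive.
Import Order.TTheory GRing.Theory Num.Theory.
Import numFieldNormedType.Exports.
Local Open Scope classical_set_scope.
Local Open Scope ring_scope.

(* For the kernel, take a polynomial close to x^s at x = |tr U|^2 / d^2, with s of
   order d^3 / eps^2 + d / sigma^2, and normalise it.  Truncating the Chebyshev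
   expansion of x^s at degree k costs only 2 exp(- k^2 / s).  Outside the ball of
   radius eps, sqrt x <= 1 - eps^2 / (2 d), so x^s is much smaller there than
   x^(s/3), whose integral is comparable to that of x^s by a volume-doubling
   argument.  The integral of x^s is bounded below by counting multisets of matrix
   entries when sigma is not too small compared to d, and by a covering argument
   near the identity otherwise.  When E = eps^2 / sigma^2 < d^2 the bound in (2)
   exceeds 1, and when k is too small (2) is void: the constant 1 then works. *)

(** * Integrals of bounded measurable functions *)

(** Write [q = 1 / sigma], [J] for the mean of [fid ^ s] and [n = d^2 - 1]. Adding a multiple of the
    truncation error makes the kernel nonnegative and at most 2 before normalisation, so the mean of
    its square is at most [2 / J], and (4) becomes [1 <= 32 * 4^(d^2) * q^(d (2 d - 1)) * J] with
    explicit constants. Counting multisets gives [1 / J <= 'C(n + s, n)], of order [q^(2 d^2 - 2)]: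
    this exceeds the target by [q^(d - 2)], harmless for [d = 2] and affordable while
    [q <= 1200 d^3]. Covering near the identity only costs [q^(d^2)], but with a factor about
    [(51 d^(5/2))^(d^2)], which the spare [q^(d (d - 1))] absorbs once [q >= 1200 d^3]. The same
    bound on [J] makes the truncation error negligible against [J], as (2) requires. The part
    [d^3 / eps^2] of the exponent [s] pays for the factor [exp (5 d^2)] lost in the doubling
    argument; [E >= d^2] keeps it below [d q^2], so that the degree allowed by (2) suffices. *)

Section BoundedMeasurable.
Context {disp : measure_display} {T : measurableType disp} {R : realType}.

Definition bmeas (f : T -> R) :=
  measurable_fun setT f /\ exists M, forall x, `|f x| <= M.

Lemma bmeas_cst c : bmeas (fun=> c).
Proof. by split; [exact: measurable_cst|exists `|c|]. Qed.

Lemma bmeasD f g : bmeas f -> bmeas g -> bmeas (fun x => f x + g x).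
Proof.
move=> [mf [M fM]] [mg [N gN]]; split; first exact: measurable_funD.
by exists (M + N) => x; rewrite (le_trans (ler_normD _ _))// lerD.
Qed.

Lemma bmeasM f g : bmeas f -> bmeas g -> bmeas (fun x => f x * g x).
Proof.
move=> [mf [M fM]] [mg [N gN]]; split; first exact: measurable_funM.
by exists (M * N) => x; rewrite normrM ler_pM.
Qed.

Lemma bmeasZ c f : bmeas f -> bmeas (fun x => c * f x).
Proof. exact/bmeasM/bmeas_cst. Qed.

Lemma bmeasX n f : bmeas f -> bmeas (fun x => f x ^+ n).
Proof.
move=> hf; elim: n => [|n IH]; first exact: bmeas_cst.
rewrite (_ : (fun x => _) = fun x => f x * f x ^+ n); first exact: bmeasM.
by apply/funext => x; rewrite exprS.
Qed.

Lemma bmeas_sum (I : Type) (r : seq I) (P : pred I) (F : I -> T -> R) :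
  (forall i, P i -> bmeas (F i)) -> bmeas (fun x => \sum_(i <- r | P i) F i x).
Proof.
move=> hF; elim: r => [|i r IH].
  rewrite (_ : (fun x => _) = fun=> 0); first exact: bmeas_cst.
  by apply/funext => x; rewrite big_nil.
case Pi : (P i).
  rewrite (_ : (fun x => _) = fun x => F i x + \sum_(i <- r | P i) F i x).
    by apply: bmeasD => //; exact: hF.
  by apply/funext => x; rewrite big_cons Pi.
by rewrite (_ : (fun x => _) = fun x => \sum_(i <- r | P i) F i x)//;
  apply/funext => x; rewrite big_cons Pi.
Qed.

Lemma bmeas_indic (A : set T) : measurable A -> bmeas (\1_A : T -> R).
Proof.
move=> mA; split; first exact: measurable_indic.
by exists 1 => x; rewrite indicE; case: (x \in A); rewrite ?normr1 ?normr0.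
Qed.

Variable mu : probability T R.

Lemma bmeas_integrable f : bmeas f -> mu.-integrable setT (EFin \o f).
Proof.
move=> [mf [M fM]]; apply: measurable_bounded_integrable => //.
  by have := @fin_num_measure _ _ _ mu setT measurableT; rewrite fin_numE => /andP[_]; rewrite ltey.
exists M; split; first exact: num_real.
by move=> y My x _; exact: (le_trans (fM x) (ltW My)).
Qed.

Local Notation mean f := (\int[mu]_x (f x))%R.

Lemma EFin_mean f : bmeas f -> (\int[mu]_x (f x)%:E)%E = (mean f)%:E.
Proof.
move=> hf; rewrite /Rintegral fineK//.
by apply: integrable_fin_num => //; exact: bmeas_integrable.
Qed.

Lemma mean_cst c : mean (fun=> c) = c.
Proof.
rewrite Rintegral_cst// (_ : fine _ = 1) ?mulr1// -[RHS]/(fine 1%E).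
by congr fine; exact: probability_setT.
Qed.

Lemma meanD f g : bmeas f -> bmeas g ->
  mean (fun x => f x + g x) = mean f + mean g.
Proof. by move=> hf hg; rewrite RintegralD//; exact: bmeas_integrable. Qed.

Lemma meanZ c f : bmeas f -> mean (fun x => c * f x) = c * mean f.
Proof. by move=> hf; rewrite RintegralZl//; exact: bmeas_integrable. Qed.

Lemma le_mean f g : bmeas f -> bmeas g -> (forall x, f x <= g x) ->
  mean f <= mean g.
Proof. by move=> hf hg fg; apply: le_Rintegral => //; exact: bmeas_integrable. Qed.

Lemma mean_sum (I : Type) (r : seq I) (P : pred I) (F : I -> T -> R) :
  (forall i, P i -> bmeas (F i)) ->
  mean (fun x => \sum_(i <- r | P i) F i x) = \sum_(i <- r | P i) mean (F i).
Proof.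
move=> hF; elim: r => [|i r IH].
  rewrite big_nil -[RHS](mean_cst 0); congr (fine _).
  by apply: eq_integral => x _; rewrite big_nil.
rewrite big_cons; case Pi : (P i).
  rewrite -IH -meanD//; [|exact: hF|exact: bmeas_sum].
  by apply: eq_Rintegral => x _; rewrite big_cons Pi.
by rewrite -IH; apply: eq_Rintegral => x _; rewrite big_cons Pi.
Qed.

End BoundedMeasurable.

(** * Chebyshev truncation of powers *)

Section LazyWalk.
Variable R : realType.
Implicit Types (g h : int -> R) (z : int) (x y t v phi : R).

(** Termwise comparison of power series: the odd terms on the left cancel, and the even ones compare
    because [2^k k! <= (2k)!]. *)
Lemma expR_add_expRN_le v : expR v + expR (- v) <= 2 * expR (v ^+ 2 / 2).
Proof.
pose S (x : R) : R^nat := series (exp_coeff x).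
have cvS x : S x @ \oo --> expR x by exact: is_cvg_series_exp_coeff.
have S_le x n : 0 <= x -> S x n <= expR x.
  move=> x0; apply: nondecreasing_cvgn_le; last exact: is_cvg_series_exp_coeff.
  apply/nondecreasing_seqP => k; rewrite /S seriesSr lerDl.
  exact: exp_coeff_ge0.
have fac2 k : (2 ^ k * k`! <= (k.*2)`!)%N.
  elim: k => // k IH; rewrite doubleS !factS expnS.
  rewrite (_ : (2 * 2 ^ k * (k.+1 * k`!) = (k.*2.+2 * (2 ^ k * k`!)))%N); last first.
    by rewrite -doubleS -mul2n -!mulnA; congr muln; rewrite mulnCA.
  rewrite leq_mul2l; apply/orP; right; rewrite (leq_trans IH)// leq_pmull//.
(* [uphalf n] is the number of even indices below [n]. *)
have step n : S v n + S (- v) n <= 2 * S (v ^+ 2 / 2) (uphalf n).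
  elim: n => [|n IH]; first by rewrite /S /series/= !big_geq// addr0 mulr0.
  have -> : S v n.+1 + S (- v) n.+1 =
      (S v n + S (- v) n) + (v ^+ n / n`!%:R + (- v) ^+ n / n`!%:R).
    by rewrite /S !seriesSr /exp_coeff/=; ring.
  case: (boolP (odd n)) => on.
    rewrite exprNn -signr_odd on expr1 mulN1r mulNr subrr addr0.
    by rewrite (_ : uphalf n.+1 = uphalf n)//= uphalf_half on.
  have [k nk] : exists k, n = k.*2.
    by exists n./2; rewrite -[LHS]odd_double_half (negbTE on).
  have -> : uphalf n.+1 = (uphalf n).+1 by rewrite nk /= uphalf_double doubleK.
  rewrite [in leRHS]/S seriesSr mulrDr lerD// exprNn -signr_odd (negbTE on) expr0 mul1r.
  suff : v ^+ n / n`!%:R <= exp_coeff (v ^+ 2 / 2) (uphalf n) by lra.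
  rewrite nk uphalf_double /exp_coeff/=.
  rewrite -mul2n exprM expr_div_n -mulrA -invfM.
  apply: ler_wpM2l; first by rewrite exprn_ge0// sqr_ge0.
  rewrite lef_pV2 ?posrE ?ltr0n ?fact_gt0 ?mulr_gt0 ?exprn_gt0 ?ltr0n ?fact_gt0//.
  by rewrite -natrX -natrM ler_nat mul2n.
have cv : (fun n => S v n + S (- v) n) @ \oo --> expR v + expR (- v).
  by apply: cvgD; exact: cvS.
rewrite -(cvg_lim _ cv)//; apply: limr_le; first by apply/cvg_ex; eexists; exact: cv.
apply: nearW => n; apply: (le_trans (step n)); rewrite ler_pM2l// S_le//.
by rewrite divr_ge0// sqr_ge0.
Qed.

(* [cos (z phi)] is an eigenfunction of this averaging operator, with eigenvalue
   [(1 + cos phi) / 2]. *)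
Definition lazy g z := g z / 2 + (g (z - 1) + g (z + 1)) / 4.

Lemma iter_lazy_eigen g (c : R) s :
  (forall z, lazy g z = c * g z) -> forall z, iter s lazy g z = c ^+ s * g z.
Proof.
move=> hg; elim: s => [z|s IH z] /=; first by rewrite expr0 mul1r.
rewrite exprSr -mulrA -hg /lazy !IH; ring.
Qed.

(** [lazy] averages with nonnegative weights, so it preserves a majorant of the difference. *)
Lemma iter_lazy_dist g1 g2 h s : (forall z, `|g1 z - g2 z| <= h z) ->
  forall z, `|iter s lazy g1 z - iter s lazy g2 z| <= iter s lazy h z.
Proof.
move=> hg; elim: s => [//|s IH z] /=; rewrite /lazy.
move: (IH z) (IH (z - 1)) (IH (z + 1)).
rewrite !ler_norml => /andP[? ?] /andP[? ?] /andP[? ?]; apply/andP; split; lra.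
Qed.

Lemma lazy_cos phi z : lazy (fun z => cos (z%:~R * phi)) z =
  (1 + cos phi) / 2 * cos (z%:~R * phi).
Proof.
rewrite /lazy intrB intrD mulrBl (mulrDl _ _ phi) !mul1r !cosD cosN sinN.
by field.
Qed.

Lemma lazy_exp t z : lazy (fun z => expR (z%:~R * t) + expR (- (z%:~R * t))) z =
  (2 + expR t + expR (- t)) / 4 * (expR (z%:~R * t) + expR (- (z%:~R * t))).
Proof.
rewrite /lazy intrB intrD mulrBl (mulrDl _ _ t) !mul1r !opprD !expRD opprK.
by field.
Qed.

(** The left side is [cosh (t / 2) ^ 2], and [cosh (t / 2) <= exp (t^2 / 8)]. *)
Lemma lazy_exp_factor t : (2 + expR t + expR (- t)) / 4 <= expR (t ^+ 2 / 4).
Proof.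
have := expR_add_expRN_le (t / 2).
set a := expR (t / 2); set b := expR (- _); set c := expR _.
have -> : expR t = a ^+ 2 by rewrite expr2 -expRD; congr expR; field.
have -> : expR (- t) = b ^+ 2 by rewrite expr2 -expRD; congr expR; field.
have -> : expR (t ^+ 2 / 4) = c ^+ 2 by rewrite [RHS]expr2 -expRD; congr expR; field.
have ab : a * b = 1 by rewrite -expRD subrr expR0.
have a0 : 0 < a := expR_gt0 _.
have b0 : 0 < b := expR_gt0 _.
move=> h; rewrite (_ : _ / 4 = ((a + b) / 2) ^+ 2); last first.
  have <- : (a + b) ^+ 2 = 2 + a ^+ 2 + b ^+ 2.
    by transitivity (a ^+ 2 + 2 * (a * b) + b ^+ 2); [ring|rewrite ab; ring].
  by field.
by rewrite lerXn2r ?nnegrE; lra.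
Qed.

(** Chebyshev polynomials of the first kind; carrying two consecutive ones makes the two-step
    recurrence structural. *)
Fixpoint cheb2 n y : R * R :=
  if n is n.+1 then let: (a, b) := cheb2 n y in (b, 2 * y * b - a) else (1, y).
Definition cheb n y := (cheb2 n y).1.

Lemma cheb0 y : cheb 0 y = 1. Proof. by []. Qed.
Lemma cheb1 y : cheb 1 y = y. Proof. by []. Qed.
Lemma chebSS n y : cheb n.+2 y = 2 * y * cheb n.+1 y - cheb n y.
Proof. by rewrite /cheb/=; case: (cheb2 n y). Qed.

Lemma cheb_cos n phi : cheb n (cos phi) = cos (n%:R * phi).
Proof.
suff : cheb n (cos phi) = cos (n%:R * phi) /\
    cheb n.+1 (cos phi) = cos (n.+1%:R * phi) by case.
elim: n => [|n [IH1 IH2]]; first by rewrite mul0r cos0 mul1r cheb0 cheb1.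
split=> //; rewrite chebSS IH1 IH2.
have -> : n.+2%:R * phi = n.+1%:R * phi + phi by rewrite -addn1 natrD mulrDl mul1r.
have -> : n%:R * phi = n.+1%:R * phi - phi by rewrite -addn1 natrD mulrDl mul1r addrK.
by rewrite !cosD cosN sinN; ring.
Qed.

(* Without the truncation at [|z| <= m] this is [x ^+ s], because [cheb n] evaluated
   at [cos phi = 2 x - 1] is [cos (n phi)]; with it, the degree in [x] is at most [m]. *)
Definition trunc_pow s m x :=
  iter s lazy (fun z => if (`|z| <= m)%N then cheb `|z|%N (2 * x - 1) else 0) 0.

(** A Chernoff bound: [x ^+ s] is the expectation of [cos (Z phi)] for a lazy walk [Z] of [s] steps,
    and truncation only affects the event [|Z| > m]. *)
Lemma trunc_pow_dist s m x : (0 < s)%N -> 0 <= x <= 1 ->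
  `|trunc_pow s m x - x ^+ s| <= 2 * expR (- (m%:R ^+ 2 / s%:R)).
Proof.
move=> s0 /andP[x0 x1].
pose phi := acos (2 * x - 1).
have cphi : cos phi = 2 * x - 1 by rewrite acosK// in_itv/=; apply/andP; split; lra.
have xs : x ^+ s = iter s lazy (fun z => cos (z%:~R * phi)) 0.
  rewrite (iter_lazy_eigen (c := x)); first by rewrite mul0r cos0 mulr1.
  by move=> z; rewrite lazy_cos cphi; congr (_ * _); field.
(* Minimises the exponent [- m t + s t^2 / 4]; the minimum is [- m^2 / s]. *)
pose t := 2 * m%:R / s%:R : R.
have sR : 0 < s%:R :> R by rewrite ltr0n.
have t0 : 0 <= t by rewrite divr_ge0// mulr_ge0.
(* [h] dominates the indicator of [|z| > m] and is an eigenfunction of [lazy]. *)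
pose h z := expR (- (m%:R * t)) * (expR (z%:~R * t) + expR (- (z%:~R * t))).
rewrite xs; apply: (le_trans (iter_lazy_dist (h := h) s _ 0)) => [z|].
  have chebz : cheb `|z|%N (2 * x - 1) = cos (z%:~R * phi).
    rewrite -cphi cheb_cos -[RHS]cos_norm -[LHS]cos_norm !normrM.
    by rewrite -intr_norm -abszE normr_nat.
  rewrite chebz /h; case: leqP => mz.
    by rewrite subrr normr0 mulr_ge0 ?addr_ge0 ?expR_ge0.
  rewrite sub0r normrN (le_trans (cos_max _))// mulrDr -!expRD.
  have mz' : m%:R <= `|z%:~R| :> R.
    by rewrite -intr_norm -abszE ler_nat ltnW.
  have key w : m%:R <= w -> 1 <= expR (- (m%:R * t) + w * t).
    by move=> mw; rewrite -[leLHS]expR0 ler_expR addrC subr_ge0 ler_wpM2r.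
  have [z0|z0] := leP 0 (z%:~R : R).
    rewrite (ger0_norm z0) in mz'.
    by rewrite (le_trans (key _ mz'))// lerDl expR_ge0.
  rewrite (ltr0_norm z0) in mz'.
  by rewrite (le_trans (key _ mz'))// -mulNr lerDr expR_ge0.
rewrite (iter_lazy_eigen (c := (2 + expR t + expR (- t)) / 4)); last first.
  by move=> z; rewrite /h /lazy -[_ / 4 * (_ * _)]mulrCA -lazy_exp /lazy; ring.
rewrite /h mul0r oppr0 expR0 -[1 + 1]/(2 : R) mulrCA [in leRHS]mulrC mulrA.
rewrite ler_pM2r// (_ : - (m%:R ^+ 2 / s%:R) = - (m%:R * t) + s%:R * (t ^+ 2 / 4)).
  rewrite expRD ler_wpM2l ?expR_ge0// expRM_natl.
  rewrite lerXn2r ?nnegrE ?expR_ge0 ?lazy_exp_factor//.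
by rewrite /t; field; rewrite gt_eqF.
Qed.

End LazyWalk.

(** * The Frobenius norm and unitary matrices *)

Section ComplexMatrices.
Variable R : realType.
Local Notation C := (complex R).

Definition sqn (z : C) : R := complex.Re z ^+ 2 + complex.Im z ^+ 2.

Lemma sqn_ge0 z : 0 <= sqn z.
Proof. by rewrite addr_ge0// sqr_ge0. Qed.

Lemma sqn_eq0 z : (sqn z == 0) = (z == 0).
Proof.
case: z => a b; rewrite /sqn/= paddr_eq0 ?sqr_ge0// !sqrf_eq0.
by rewrite eq_complex.
Qed.

Lemma sqnM z1 z2 : sqn (z1 * z2) = sqn z1 * sqn z2.
Proof. by case: z1 z2 => [a b] [a' b']; rewrite /sqn/=; ring. Qed.

Lemma sqn_conjc z : sqn (conjc z) = sqn z.
Proof. by case: z => a b; rewrite /sqn/= sqrrN. Qed.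

Lemma sqnC (a : R) : sqn a%:C%C = a ^+ 2.
Proof. by rewrite /sqn/= expr0n/= addr0. Qed.

Lemma conjc_mul z : conjc z * z = (sqn z)%:C%C.
Proof.
case: z => a b; apply/eqP; rewrite eq_complex /sqn/=; apply/andP; split; apply/eqP; ring.
Qed.

Lemma Re_sqr_le z : complex.Re z ^+ 2 <= sqn z.
Proof. by rewrite lerDl sqr_ge0. Qed.

Lemma Im_sqr_le z : complex.Im z ^+ 2 <= sqn z.
Proof. by rewrite lerDr sqr_ge0. Qed.

Lemma sqnD z1 z2 :
  sqn (z1 + z2) = sqn z1 + sqn z2 + 2 * complex.Re (conjc z2 * z1).
Proof. by case: z1 z2 => [a b] [a' b']; rewrite /sqn/=; ring. Qed.

Lemma sqnB z1 z2 :
  sqn (z1 - z2) = sqn z1 + sqn z2 - 2 * complex.Re (conjc z2 * z1).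
Proof. by case: z1 z2 => [a b] [a' b']; rewrite /sqn/=; ring. Qed.

Lemma Re_sum (I : Type) (r : seq I) (P : pred I) (F : I -> C) :
  complex.Re (\sum_(i <- r | P i) F i) = \sum_(i <- r | P i) complex.Re (F i).
Proof. by apply: (big_morph (@complex.Re R)) => // -[a b] [a' b']. Qed.

Lemma ReZ (a : R) z : complex.Re (a%:C%C * z) = a * complex.Re z.
Proof. by case: z => x y /=; ring. Qed.

(** Cauchy-Schwarz: the sum of the [sqn (B a_i - s conjc b_i)] equals [B (A B - sqn s)]. The case
    [B = 0] is separate because [B] is cancelled. *)
Lemma sqn_sum_le (I : finType) (a b : I -> C) :
  sqn (\sum_i a i * b i) <= (\sum_i sqn (a i)) * (\sum_i sqn (b i)).
Proof.
set A := \sum_i sqn (a i); set B := \sum_i sqn (b i); set s := \sum_i _.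
have B0 : 0 <= B by apply: sumr_ge0 => i _; exact: sqn_ge0.
have [Bgt0|Ble0] := ltP 0 B; last first.
  have b0 i : b i = 0.
    apply/eqP; rewrite -sqn_eq0 eq_le sqn_ge0 andbT (le_trans _ Ble0)//.
    by rewrite /B (bigD1 i)//= lerDl sumr_ge0// => j _; exact: sqn_ge0.
  rewrite /s big1 => [|i _]; last by rewrite b0 mulr0.
  rewrite (_ : sqn 0 = 0); last by apply/eqP; rewrite sqn_eq0.
  by rewrite mulr_ge0// sumr_ge0// => i _; exact: sqn_ge0.
have : 0 <= \sum_i sqn (B%:C%C * a i - s * conjc (b i)).
  by apply: sumr_ge0 => i _; exact: sqn_ge0.
have -> : \sum_i sqn (B%:C%C * a i - s * conjc (b i)) = B * (A * B - sqn s).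
  under eq_bigr => i _.
    rewrite sqnB !sqnM sqnC sqn_conjc rmorphM /= conjcK.
    rewrite (_ : conjc s * b i * (B%:C%C * a i) = B%:C%C * (conjc s * (a i * b i))); last by ring.
    rewrite ReZ.
    over.
  rewrite sumrB big_split/= -!mulr_sumr -/A -/B.
  rewrite -Re_sum -mulr_sumr -/s conjc_mul /=; ring.
by rewrite pmulr_rge0// subr_ge0.
Qed.

Variable d : nat.
Local Notation Mx := 'M[C]_d.
Implicit Types (M N : Mx).

Definition sqF M : R := \sum_i \sum_j sqn (M i j).
Definition mdot M N : C := \sum_i \sum_j conjc (M i j) * N i j.
Definition adj M : Mx := \matrix_(i, j) conjc (M j i).

Lemma sqF_ge0 M : 0 <= sqF M.
Proof. by apply: sumr_ge0 => i _; apply: sumr_ge0 => j _; exact: sqn_ge0. Qed.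

Lemma sqn_le_sqF M i j : sqn (M i j) <= sqF M.
Proof.
rewrite /sqF (bigD1 i)//= (bigD1 j)//= -addrA lerDl addr_ge0// sumr_ge0// => k _.
  exact: sqn_ge0.
by apply: sumr_ge0 => l _; exact: sqn_ge0.
Qed.

Lemma sqFE M : sqF M = \sum_(p : 'I_d * 'I_d) sqn (M p.1 p.2).
Proof. by rewrite /sqF pair_big. Qed.

Lemma sqFZ z M : sqF (z *: M) = sqn z * sqF M.
Proof.
rewrite /sqF mulr_sumr; apply: eq_bigr => i _; rewrite mulr_sumr.
by apply: eq_bigr => j _; rewrite mxE sqnM.
Qed.

Lemma sqFB M N : sqF (M - N) = sqF M + sqF N - 2 * complex.Re (mdot N M).
Proof.
rewrite /sqF /mdot Re_sum mulr_sumr -big_split/= -sumrB; apply: eq_bigr => i _.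
rewrite Re_sum mulr_sumr -big_split/= -sumrB; apply: eq_bigr => j _.
by rewrite !mxE sqnB.
Qed.

Lemma mdotZl z M N : mdot (z *: M) N = conjc z * mdot M N.
Proof.
rewrite /mdot mulr_sumr; apply: eq_bigr => i _; rewrite mulr_sumr.
by apply: eq_bigr => j _; rewrite mxE rmorphM mulrA.
Qed.

Lemma mdotZr z M N : mdot M (z *: N) = z * mdot M N.
Proof.
rewrite /mdot mulr_sumr; apply: eq_bigr => i _; rewrite mulr_sumr.
by apply: eq_bigr => j _; rewrite mxE mulrCA.
Qed.

Lemma mdot_trace M N : mdot M N = \tr (adj M *m N).
Proof.
rewrite /mdot exchange_big; apply: eq_bigr => j _; rewrite mxE.
by apply: eq_bigr => i _; rewrite mxE.
Qed.

Lemma mdot1 M : mdot 1%:M M = \tr M.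
Proof.
rewrite /mdot /mxtrace; apply: eq_bigr => i _.
rewrite (bigD1 i)//= mxE eqxx rmorph1 mul1r big1 ?addr0// => j ji.
by rewrite mxE eq_sym (negbTE ji) rmorph0 mul0r.
Qed.

Lemma sqF_mdot M : mdot M M = (sqF M)%:C%C.
Proof.
rewrite /mdot /sqF rmorph_sum; apply: eq_bigr => i _.
by rewrite rmorph_sum; apply: eq_bigr => j _; rewrite conjc_mul.
Qed.

Lemma sqn_mdot_le M N : sqn (mdot M N) <= sqF M * sqF N.
Proof.
rewrite /mdot pair_big /= (le_trans (sqn_sum_le _ _))// !sqFE ler_wpM2r//.
  by apply: sumr_ge0 => i _; exact: sqn_ge0.
by under eq_bigr do rewrite sqn_conjc.
Qed.

Lemma adjK M : adj (adj M) = M.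
Proof. by apply/matrixP => i j; rewrite !mxE conjcK. Qed.

Lemma unitary_adj M : M \is unitarymx -> M *m adj M = 1%:M.
Proof.
move=> /unitarymxP; rewrite (_ : (_ ^ _)%sesqui = adj M)//.
by apply/matrixP => i j; rewrite !mxE.
Qed.

Lemma adj_unitary M : M \is unitarymx -> adj M *m M = 1%:M.
Proof. by move=> /unitary_adj/mulmx1C. Qed.

Lemma adj_is_unitary M : M \is unitarymx -> adj M \is unitarymx.
Proof.
move=> hM; apply/unitarymxP; rewrite (_ : (_ ^ _)%sesqui = adj (adj M)).
  by rewrite adjK adj_unitary.
by apply/matrixP => i j; rewrite !mxE.
Qed.

Lemma sqF_unitary M : M \is unitarymx -> sqF M = d%:R.
Proof.
move=> /adj_unitary hM; apply: complexI; rewrite -sqF_mdot mdot_trace hM mxtrace1.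
by rewrite rmorph_nat.
Qed.

End ComplexMatrices.

(** * Measurability and translation invariance on the unitary group *)

Section UnitaryGroup.
Variables (R : realType) (d : nat).
Local Notation Ud := (Ud R d).
Local Notation UdM := (UdM R d).

Definition Ud_adj (V : Ud) : Ud := exist _ (adj (val V)) (adj_is_unitary (valP V)).

Definition Ud_div (V U : Ud) : Ud := Ud_mul (Ud_adj V) U.

Lemma trace_Ud_div V U : \tr (val (Ud_div V U)) = mdot (val V) (val U).
Proof. by rewrite mdot_trace. Qed.

Lemma sqF_Ud (U : Ud) : sqF (val U) = d%:R.
Proof. exact/sqF_unitary/(valP U). Qed.

Lemma sqF_Ud_div V U : sqF (val (Ud_div V U) - 1%:M) = sqF (val U - val V).
Proof.
rewrite !sqFB !sqF_Ud mdot1 trace_Ud_div.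
by rewrite -[1%:M]/(val (Ud1 R d)) sqF_Ud.
Qed.

Lemma measurable_Ud_Re i j : measurable_fun setT (fun U : UdM => complex.Re (val U i j)).
Proof.
move=> _ B mB; rewrite setTI; apply: sub_sigma_algebra.
by exists i, j, B; split => //; left.
Qed.

Lemma measurable_Ud_Im i j : measurable_fun setT (fun U : UdM => complex.Im (val U i j)).
Proof.
move=> _ B mB; rewrite setTI; apply: sub_sigma_algebra.
by exists i, j, B; split => //; right.
Qed.

Definition cmeas (f : UdM -> complex R) :=
  measurable_fun setT (fun U => complex.Re (f U)) /\
  measurable_fun setT (fun U => complex.Im (f U)).

Lemma cmeas_entry i j : cmeas (fun U => val U i j).
Proof. by split; [exact: measurable_Ud_Re|exact: measurable_Ud_Im]. Qed.

Lemma cmeas_cst z : cmeas (fun=> z).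
Proof. by split; exact: measurable_cst. Qed.

Lemma cmeasD f g : cmeas f -> cmeas g -> cmeas (fun U => f U + g U).
Proof.
move=> [fr fi] [gr gi]; split.
  rewrite (_ : (fun U => _) = fun U => complex.Re (f U) + complex.Re (g U)).
    exact: measurable_funD.
  by apply/funext => U; case: (f U) (g U) => [a b] [a' b'].
rewrite (_ : (fun U => _) = fun U => complex.Im (f U) + complex.Im (g U)).
  exact: measurable_funD.
by apply/funext => U; case: (f U) (g U) => [a b] [a' b'].
Qed.

Lemma cmeasM f g : cmeas f -> cmeas g -> cmeas (fun U => f U * g U).
Proof.
move=> [fr fi] [gr gi]; split.
  rewrite (_ : (fun U => _) = fun U => complex.Re (f U) * complex.Re (g U)
                                     - complex.Im (f U) * complex.Im (g U)).
    by apply: measurable_funB; exact: measurable_funM.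
  by apply/funext => U; case: (f U) (g U) => [a b] [a' b'].
rewrite (_ : (fun U => _) = fun U => complex.Re (f U) * complex.Im (g U)
                                   + complex.Im (f U) * complex.Re (g U)).
  by apply: measurable_funD; exact: measurable_funM.
by apply/funext => U; case: (f U) (g U) => [a b] [a' b'].
Qed.

Lemma cmeas_conjc f : cmeas f -> cmeas (fun U => conjc (f U)).
Proof.
move=> [fr fi]; split.
  rewrite (_ : (fun U => _) = fun U => complex.Re (f U))//.
  by apply/funext => U; case: (f U).
rewrite (_ : (fun U => _) = fun U => - complex.Im (f U)).
  exact: measurableT_comp.
by apply/funext => U; case: (f U).
Qed.

Lemma cmeas_real (f : UdM -> R) : measurable_fun setT f -> cmeas (fun U => (f U)%:C%C).
Proof. by move=> mf; split => //=; exact: measurable_cst. Qed.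

Lemma cmeas_sum (I : Type) (r : seq I) (F : I -> UdM -> complex R) :
  (forall i, cmeas (F i)) -> cmeas (fun U => \sum_(i <- r) F i U).
Proof.
move=> hF; elim: r => [|i r IH].
  rewrite (_ : (fun U => _) = fun=> 0); first exact: cmeas_cst.
  by apply/funext => U; rewrite big_nil.
rewrite (_ : (fun U => _) = fun U => F i U + \sum_(i <- r) F i U).
  exact: cmeasD.
by apply/funext => U; rewrite big_cons.
Qed.

Lemma cmeas_prod (I : Type) (r : seq I) (F : I -> UdM -> complex R) :
  (forall i, cmeas (F i)) -> cmeas (fun U => \prod_(i <- r) F i U).
Proof.
move=> hF; elim: r => [|i r IH].
  rewrite (_ : (fun U => _) = fun=> 1); first exact: cmeas_cst.
  by apply/funext => U; rewrite big_nil.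
rewrite (_ : (fun U => _) = fun U => F i U * \prod_(i <- r) F i U).
  exact: cmeasM.
by apply/funext => U; rewrite big_cons.
Qed.

Lemma cmeas_trace : cmeas (fun U => \tr (val U)).
Proof. by rewrite /mxtrace; apply: cmeas_sum => i; exact: cmeas_entry. Qed.

Lemma measurable_sqn f : cmeas f -> measurable_fun setT (fun U => sqn (f U)).
Proof.
by move=> [fr fi]; apply: measurable_funD; exact: measurable_funX.
Qed.

Lemma measurable_Ud_mul (V : Ud) : measurable_fun setT (Ud_mul V : UdM -> UdM).
Proof.
have cm i j : cmeas (fun U => (val V *m val U) i j).
  have -> : (fun U : UdM => (val V *m val U) i j) = fun U => \sum_k val V i k * val U k j.
    by apply/funext => U; rewrite mxE.
  by apply: cmeas_sum => k; apply: cmeasM; [exact: cmeas_cst|exact: cmeas_entry].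
have := @measurability _ _ UdM UdM setT (Ud_mul V) (@Ud_gen R d) erefl.
apply => _ [_ [i [j [B [mB [->|->]]]]] <-].
  by have := (cm i j).1 measurableT B mB.
by have := (cm i j).2 measurableT B mB.
Qed.

Variable mu : probability UdM R.
Hypothesis haar : is_haar mu.
Local Notation mean f := (\int[mu]_x (f x))%R.

Lemma mean_Ud_mul (V : Ud) (f : UdM -> R) : bmeas f ->
  mean (fun U => f (Ud_mul V U)) = mean f.
Proof.
move=> bf; rewrite /Rintegral; congr fine.
have mV := measurable_Ud_mul V.
transitivity (\int[pushforward mu (Ud_mul V : UdM -> UdM)]_U (f U)%:E)%E.
  have mf : measurable_fun setT (EFin \o f) by apply/measurable_EFinP; exact: bf.1.
  rewrite (integral_pushforward mV mf)// preimage_setT.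
  apply: bmeas_integrable; split.
    exact: (measurableT_comp bf.1).
  by case: bf => _ [M fM]; exists M.
by apply: eq_measure_integral => A mA _; exact: haar.
Qed.

End UnitaryGroup.

(** * Balanced polynomials and the distance to the identity *)

Section BalancedPolynomials.
Variables (R : realType) (d : nat).
Local Notation Ud := (Ud R d).
Local Notation C := (complex R).
Implicit Types (f g : Ud -> R).

Definition mulb (x y : bterm R d) : bterm R d :=
  let pair (u : 'I_(bdeg x) -> 'I_d) (v : 'I_(bdeg y) -> 'I_d) a :=
    match fintype.split a with inl a1 => u a1 | inr a2 => v a2 end in
  BTerm (bcoef x * bcoef y) (pair (@bi _ _ x) (@bi _ _ y))
    (pair (@bj _ _ x) (@bj _ _ y)) (pair (@bk _ _ x) (@bk _ _ y))
    (pair (@bl _ _ x) (@bl _ _ y)).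

Lemma bterm_eval_mulb x y (M : 'M[C]_d) :
  bterm_eval (mulb x y) M = bterm_eval x M * bterm_eval y M.
Proof.
rewrite /bterm_eval /= !big_split_ord /=.
under eq_bigr do rewrite (unsplitK (inl _)).
under [X in _ * (_ * X) * _]eq_bigr do rewrite (unsplitK (inr _)).
under [X in _ * (X * _)]eq_bigr do rewrite (unsplitK (inl _)).
under [X in _ * (_ * X)]eq_bigr do rewrite (unsplitK (inr _)).
by ring.
Qed.

Lemma all_allpairs (S T W : Type) (a : pred S) (b : pred T) (c : pred W)
    (h : S -> T -> W) s t : (forall x y, a x -> b y -> c (h x y)) ->
  all a s -> all b t -> all c [seq h x y | x <- s, y <- t].
Proof.
move=> hc + bt; elim: s => //= x s IH /andP[ax /IH sP].
rewrite all_cat all_map; apply/andP; split => //.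
by apply: sub_all bt => y /=; exact: hc.
Qed.

Lemma in_H_leq m n f : (m <= n)%N -> in_H m f -> in_H n f.
Proof.
move=> mn [ts [hts E]]; exists ts; split => //.
by apply: sub_all hts => x /leq_trans; apply.
Qed.

Lemma in_H_cst (c : R) n : in_H n (fun _ : Ud => c).
Proof.
pose none : 'I_0 -> 'I_d := fun a => False_rect _ (notF (ltn_ord a)).
exists [:: @BTerm R d 0 c%:C%C none none none none]; split => // U.
by rewrite big_seq1 /bterm_eval /= !big_ord0 !mulr1.
Qed.

Lemma in_HD n f g : in_H n f -> in_H n g -> in_H n (fun U => f U + g U).
Proof.
move=> [s [hs Es]] [t [ht Et]]; exists (s ++ t); split; first by rewrite all_cat hs.
by move=> U; rewrite big_cat /= -Es -Et rmorphD.
Qed.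

Lemma in_HM m n f g : in_H m f -> in_H n g -> in_H (m + n) (fun U => f U * g U).
Proof.
move=> [s [hs Es]] [t [ht Et]]; exists [seq mulb x y | x <- s, y <- t]; split.
  by apply: all_allpairs hs ht => x y; exact: leq_add.
move=> U; rewrite big_allpairs_dep /= rmorphM /= Es Et big_distrlr /=.
by apply: eq_bigr => x _; apply: eq_bigr => y _; rewrite bterm_eval_mulb.
Qed.

Lemma in_HZ n c f : in_H n f -> in_H n (fun U => c * f U).
Proof. by move=> /(in_HM (in_H_cst c 0)). Qed.

Lemma in_HB n f g : in_H n f -> in_H n g -> in_H n (fun U => f U - g U).
Proof.
move=> hf /(in_HZ (-1)) hg; rewrite (_ : (fun U => _) = fun U => f U + -1 * g U).
  exact: in_HD.
by apply/funext => U; rewrite mulN1r.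
Qed.

(** The entanglement fidelity of the channel with the identity: it ignores phases and is balanced of
    degree 1. *)
Definition fid (U : Ud) : R := sqn (\tr (val U)) / d%:R ^+ 2.

Lemma in_H_fid : in_H 1 fid.
Proof.
rewrite (_ : fid = fun U => (d%:R ^+ 2)^-1 * sqn (\tr (val U))); last first.
  by apply/funext => U; rewrite mulrC.
apply: in_HZ.
exists [seq @BTerm R d 1 1 (fun=> i) (fun=> i) (fun=> j) (fun=> j)
  | i <- enum 'I_d, j <- enum 'I_d]; split.
  by apply: (@all_allpairs _ _ _ predT predT); rewrite ?all_predT.
move=> U; rewrite big_allpairs_dep /= -conjc_mul /mxtrace rmorph_sum mulrC.
rewrite big_distrlr /= !big_enum /=; apply: eq_bigr => i _.
by rewrite big_enum /=; apply: eq_bigr => j _; rewrite /bterm_eval /= !big_ord1 mul1r.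
Qed.

Lemma in_H_cheb n : in_H n (fun U : Ud => cheb n (2 * fid U - 1)).
Proof.
have hy : in_H 1 (fun U : Ud => 2 * fid U - 1).
  by apply: in_HB; [exact/in_HZ/in_H_fid|exact: in_H_cst].
suff : in_H n (fun U : Ud => cheb n (2 * fid U - 1)) /\
  in_H n.+1 (fun U : Ud => cheb n.+1 (2 * fid U - 1)) by case.
elim: n => [|n [IH1 IH2]]; first by split => //; exact: in_H_cst.
split => //.
rewrite (_ : (fun U => _) = fun U => 2 * ((2 * fid U - 1) * cheb n.+1 (2 * fid U - 1))
   - cheb n (2 * fid U - 1)); last by apply/funext => U; rewrite chebSS mulrA.
apply: in_HB; last by apply: in_H_leq IH1; rewrite -addn2 leq_addr.
by apply: in_HZ; rewrite -add1n; exact: in_HM.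
Qed.

Lemma in_H_iter_lazy n (g : Ud -> int -> R) s :
  (forall z, in_H n (fun U => g U z)) ->
  forall z, in_H n (fun U => iter s (@lazy R) (g U) z).
Proof.
move=> hg; elim: s => [//|s IH] z /=.
rewrite /lazy (_ : (fun U => _) = fun U => 2^-1 * iter s (@lazy R) (g U) z +
   4^-1 * (iter s (@lazy R) (g U) (z - 1) + iter s (@lazy R) (g U) (z + 1))); last first.
  by apply/funext => U; rewrite mulrC [in RHS](mulrC 4^-1).
by apply: in_HD; apply: in_HZ => //; exact: in_HD.
Qed.

Lemma in_H_trunc_pow s m : in_H m (fun U : Ud => trunc_pow s m (fid U)).
Proof.
apply: in_H_iter_lazy => z; case: leqP => zm; last exact: in_H_cst.
exact/in_H_leq/in_H_cheb.
Qed.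

Lemma sqn_cexp (a : R) : sqn (cexp a) = 1.
Proof. by rewrite /sqn/= cos2Dsin2. Qed.

Lemma phase_invariant_fid (g : R -> R) : phase_invariant (fun U : Ud => g (fid U)).
Proof.
move=> U W a WU; congr g; rewrite /fid WU; congr (_ / _).
by rewrite mxtraceZ sqnM sqn_cexp mul1r.
Qed.

Lemma fid_ge0 U : 0 <= fid U.
Proof. by rewrite divr_ge0 ?sqn_ge0// sqr_ge0. Qed.

Lemma fid_le1 U : fid U <= 1.
Proof.
have [d0|d0] := posnP d.
  (* For [d = 0] the inverse of zero is zero, so [fid U = 0]. *)
  have dR : d%:R = 0 :> R by rewrite d0.
  by rewrite /fid dR expr0n /= invr0 mulr0 ler01.
rewrite /fid ler_pdivrMr ?exprn_gt0 ?ltr0n// mul1r.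
have := sqn_mdot_le (val (Ud1 R d)) (val U).
by rewrite mdot1 !sqF_Ud expr2.
Qed.

Lemma sqrt_fid U : (0 < d)%N -> Num.sqrt (sqn (\tr (val U))) = d%:R * Num.sqrt (fid U).
Proof.
move=> d0; rewrite /fid sqrtrM ?sqn_ge0// sqrtrV ?sqr_ge0// sqrtr_sqr.
by rewrite ger0_norm// mulrCA mulfV ?mulr1// pnatr_eq0 -lt0n.
Qed.

Lemma measurable_fid : measurable_fun setT (fid : UdM R d -> R).
Proof.
apply: measurable_funM; last exact: measurable_cst.
by apply: measurable_sqn; exact: cmeas_trace.
Qed.

Lemma bmeas_fid : bmeas (fid : UdM R d -> R).
Proof.
split; first exact: measurable_fid.
by exists 1 => U; rewrite ger0_norm ?fid_ge0// fid_le1.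
Qed.

Lemma ex_angle (a b : R) : a ^+ 2 + b ^+ 2 = 1 ->
  exists2 phi, 0 <= phi < 2 * pi & cexp phi = Complex a b.
Proof.
move=> ab.
have a1 : -1 <= a <= 1.
  by rewrite -ler_norml -(@ler_pXn2r _ 2)// ?nnegrE// expr1n real_normK ?num_real//; nra.
have sb : Num.sqrt (1 - a ^+ 2) = `|b|.
  by rewrite -sqrtr_sqr; congr Num.sqrt; lra.
have ca : cos (acos a) = a by rewrite acosK// in_itv/=.
have pi0 := pi_gt0 R.
have [b0|b0] := leP 0 b.
  exists (acos a).
    rewrite acos_ge0//= (le_lt_trans (acos_lepi a1))//; lra.
  by rewrite /cexp ca sin_acos// sb ger0_norm.
(* [b < 0] excludes [a = 1], so [acos a > 0] and the angle [2 pi - acos a] stays strictly below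
   [2 pi]. *)
have aN1 : -1 <= a < 1 by case/andP: a1 => -> a1 /=; nra.
exists (2 * pi - acos a).
  by have := acos_gt0 aN1; have := acos_lepi a1 => ? ?; apply/andP; split; lra.
have e2 : 2 * pi = pi *+ 2 :> R by rewrite mulr_natl.
rewrite /cexp cosB sinB e2 cos2pi sin2pi ca sin_acos// sb ltr0_norm//.
by congr Complex; ring.
Qed.

Lemma vnormE (x : 'cV[C]_d) : vnorm x = Num.sqrt (\sum_i sqn (x i 0)).
Proof. by []. Qed.

Lemma opnorm_ge0 (M : 'M[C]_d) : 0 <= opnorm M.
Proof.
rewrite /opnorm; set A := (X in sup X).
(* Without a supremum, [sup] has the default value 0. *)
have [hA|hA] := pselect (has_sup A); last by rewrite sup_out.
have [y Ay] := hA.1; apply: (le_trans _ (ub_le_sup hA.2 Ay)).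
by case: Ay => x _ <-; exact: sqrtr_ge0.
Qed.

Lemma opnorm_le_sqF (M : 'M[C]_d) : opnorm M <= Num.sqrt (sqF M).
Proof.
rewrite /opnorm; set A := (X in sup X).
have [A0|A0] := pselect (A !=set0); last first.
  rewrite (_ : A = set0) ?sup0 ?sqrtr_ge0//.
  by apply/seteqP; split => // x Ax; apply: A0; exists x.
apply: ge_sup => // _ [x /= x1 <-].
rewrite vnormE ler_sqrt ?sqF_ge0//.
have x1' : \sum_i sqn (x i 0) = 1.
  have := congr1 (fun a => a ^+ 2) x1; rewrite vnormE sqr_sqrtr ?expr1n//.
  by apply: sumr_ge0 => i _; exact: sqn_ge0.
apply: ler_sum => i _; rewrite mxE (le_trans (sqn_sum_le _ _))//.
by rewrite x1' mulr1.
Qed.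

(** The infimum is at most its value at the phase of [tr U], and the operator norm at most the
    Frobenius norm, whose square is there [2 d - 2 |tr U|]. *)
Lemma chan_dist_fid (U : Ud) : (0 < d)%N ->
  chan_dist (val U) 1%:M <= Num.sqrt (2 * d%:R * (1 - Num.sqrt (fid U))).
Proof.
move=> d0; set t := \tr (val U); set rho := Num.sqrt (sqn t).
have [a [b [ab1 tab]]] : exists a b, a ^+ 2 + b ^+ 2 = 1 /\
    complex.Re (conjc (Complex a b) * t) = rho.
  have [t0|t0] := eqVneq t 0.
    exists 1, 0; split; first by ring.
    by rewrite /rho t0 mulr0 /sqn /= expr0n addr0 sqrtr0.
  have rho0 : rho != 0 by rewrite sqrtr_eq0 -ltNge lt_def sqn_ge0 sqn_eq0 t0.
  have rho2 : rho ^+ 2 = sqn t by rewrite sqr_sqrtr ?sqn_ge0.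
  exists (complex.Re t / rho), (complex.Im t / rho); split.
    by rewrite !expr_div_n -mulrDl -/(sqn t) -rho2 mulfV// expf_neq0.
  move: rho2; rewrite /sqn; case: (t) => x y /= rho2.
  apply: (mulIf rho0); rewrite -[RHS]expr2 rho2; field; exact: rho0.
have [phi phi02 phiE] := ex_angle ab1.
have : chan_dist (val U) 1%:M <= opnorm (val U - cexp phi *: 1%:M).
  apply: ge_inf; last by exists phi.
  by exists 0 => _ [x _ <-]; exact: opnorm_ge0.
move=> /le_trans; apply; apply: (le_trans (opnorm_le_sqF _)).
rewrite ler_sqrt; last first.
  rewrite mulr_ge0 ?mulr_ge0// subr_ge0 -[leRHS]sqrtr1 ler_sqrt ?fid_le1//.
rewrite sqFB sqFZ sqn_cexp mul1r mdotZl mdot1 sqF_Ud -[1%:M]/(val (Ud1 R d)) sqF_Ud.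
by rewrite phiE tab /rho sqrt_fid//; lra.
Qed.

End BalancedPolynomials.

(** * Covering estimates *)

Section Cells.
Variables (R : realType) (M : nat).
Implicit Types (t h : R) (q : bool * 'I_M).

(* The sign is part of the index, so that [|t|] is comparable to [q.2 * h] on a cell. *)
Definition cell h q : set R :=
  if q.1 then [set` `[q.2%:R * h, q.2.+1%:R * h[ ]
  else [set` `]- (q.2.+1%:R * h), - (q.2%:R * h)] ].

Lemma measurable_cell h q : measurable (cell h q).
Proof. by rewrite /cell; case: q.1. Qed.

Lemma cell_cover h t : 0 < h -> `|t| < M%:R * h -> exists q, cell h q t.
Proof.
move=> h0 tM; pose i := Num.truncn (`|t| / h).
have th0 : 0 <= `|t| / h by rewrite divr_ge0// ltW.
have /andP[ile igt] := truncn_itv th0.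
have iM : (i < M)%N.
  by rewrite -(ltr_nat R) (le_lt_trans ile)// ltr_pdivrMr.
move: ile igt; rewrite -/i ler_pdivlMr// ltr_pdivrMr// => ile igt.
have [t0|t0] := leP 0 t.
  exists (true, Ordinal iM); rewrite /cell/= in_itv/=.
  by move: ile igt; rewrite ger0_norm// => -> ->.
exists (false, Ordinal iM); rewrite /cell/= in_itv/=.
by move: ile igt; rewrite ltr0_norm// lerNr ltrNl => -> ->.
Qed.

Lemma cell_norm_ge h q t : 0 < h -> cell h q t -> q.2%:R * h <= `|t|.
Proof.
move=> h0; have qh : 0 <= q.2%:R * h by rewrite mulr_ge0// ltW.
rewrite /cell; case: q.1; rewrite /= in_itv/= => /andP[t1 t2].
  by rewrite (le_trans t1)// ler_norm.
by rewrite -normrN (le_trans _ (ler_norm _))// lerNr.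
Qed.

Lemma cell_dist h q t t' : 0 < h -> cell h q t -> cell h q t' -> (t - t') ^+ 2 <= h ^+ 2.
Proof.
move=> h0 ct ct'; suff : `|t - t'| <= h.
  by move=> H; rewrite -real_normK ?num_real// lerXn2r// ?nnegrE// ltW.
move: ct ct'; rewrite /cell; set a := (val q.2)%:R * h.
have -> : (q.2.+1)%:R * h = a + h by rewrite -natr1 mulrDl mul1r.
case: q.1; rewrite /= !in_itv/= => /andP[? ?] /andP[? ?];
  rewrite ler_norml; apply/andP; split; lra.
Qed.

End Cells.

Section CellBound.
Variables (R : realType) (d : nat) (mu : probability (UdM R d) R).
Hypothesis haar : is_haar mu.
Local Notation UdM := (UdM R d).
Local Notation mean f := (\int[mu]_x (f x))%R.

(* Cut [A] into the boxes [Q] on which every coordinate [c p] stays in one cell of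
   width [h].  For [V] in [Q], left translation by the inverse of [V] sends [Q]
   into [B], so [Q] has measure at most that of [B]; the sum over all boxes of the
   maximum of [f] factorises over the coordinates. *)
Lemma mean_cell_bound (P : finType) (c : P -> UdM -> R) (M : nat) (h gamma : R)
    (A B : set UdM) (f : UdM -> R) :
  0 < h -> 0 <= gamma -> (forall p, measurable_fun setT (c p)) ->
  measurable A -> measurable B -> bmeas f ->
  (forall U p, A U -> `|c p U| < M%:R * h) ->
  (forall U V, A U -> A V -> \sum_p (c p U - c p V) ^+ 2 <= #|P|%:R * h ^+ 2 ->
     B (Ud_div V U)) ->
  (forall U, A U -> f U <= expR (- (gamma * \sum_p (c p U / h) ^+ 2))) ->
  (forall U, ~ A U -> f U <= 0) ->
  mean f <= (2 * \sum_(i < M) expR (- (gamma * i%:R ^+ 2))) ^+ #|P| * mean (\1_B).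
Proof.
move=> h0 g0 mc mA mB bf cM cB fA fNA.
pose e (q : bool * 'I_M) := expR (- (gamma * q.2%:R ^+ 2)) : R.
pose wt (q : {ffun P -> bool * 'I_M}) := \prod_p e (q p).
pose Q (q : {ffun P -> bool * 'I_M}) : set UdM :=
  A `&` \big[setI/setT]_(p <- enum P) (c p @^-1` cell h (q p)).
have QP q U : Q q U <-> A U /\ forall p, cell h (q p) (c p U).
  rewrite /Q -bigcap_seq; split => [[AU cU]|[AU cU]]; split => // p.
    by apply: (cU p); rewrite /= mem_enum.
  by move=> _; exact: cU.
have mQ q : measurable (Q q).
  apply: measurableI => //; apply: bigsetI_measurable => p _.
  by rewrite -[X in measurable X]setTI; apply: mc => //; exact: measurable_cell.
have wt0 q : 0 <= wt q by apply: prodr_ge0 => p _; exact: expR_ge0.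
have fle U : f U <= \sum_q wt q * \1_(Q q) U.
  have [AU|nAU] := pselect (A U); last first.
    apply: (le_trans (fNA _ nAU)); apply: sumr_ge0 => q _.
    by rewrite mulr_ge0// indicE; case: (_ \in _).
  have /fin_all_exists[q0 q0P] : forall p, exists q : bool * 'I_M, cell h q (c p U).
    by move=> p; apply: cell_cover => //; exact: cM.
  pose q := [ffun p => q0 p]; have QU : Q q U by apply/QP; split => // p; rewrite ffunE.
  rewrite (bigD1 q)//= (le_trans (fA _ AU))//.
  rewrite -[leLHS]addr0 lerD//; last first.
    by apply: sumr_ge0 => q' _; rewrite mulr_ge0// indicE; case: (_ \in _).
  rewrite indicE mem_set// mulr1 /wt /e -expR_sum ler_expR.
  rewrite sumrN lerN2 -mulr_sumr ler_wpM2l// ler_sum// => p _.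
  have := cell_norm_ge h0 (((QP q U).1 QU).2 p) => H.
  rewrite -[leRHS]real_normK ?num_real// lerXn2r ?nnegrE// normrM normfV (gtr0_norm h0).
  by rewrite ler_pdivlMr.
have bQ q : bmeas (\1_(Q q) : UdM -> R) by exact: bmeas_indic.
apply: (le_trans (le_mean mu bf _ fle)).
  by apply: bmeas_sum => q _; exact: bmeasZ.
rewrite mean_sum; last by move=> q _; exact: bmeasZ.
have bB : bmeas (\1_B : UdM -> R) by exact: bmeas_indic.
have QB q : mean (\1_(Q q)) <= mean (\1_B).
  have [[V QV]|Q0] := pselect (exists V, Q q V); last first.
    rewrite (_ : Q q = set0); last first.
      by apply/seteqP; split => // U QU; apply: Q0; exists U.
    apply: le_mean => //; first exact: bmeas_indic.
    by move=> U; rewrite !indicE in_set0; case: (_ \in _).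
  rewrite -(mean_Ud_mul haar (Ud_adj V) bB); apply: le_mean => //.
    split; last by case: bB => _ [N BN]; exists N.
    by apply: measurableT_comp (bB.1) _; exact: measurable_Ud_mul.
  move=> U; rewrite !indicE; have [QU|nQU] := pselect (Q q U); last first.
    by rewrite (memNset nQU); case: (_ \in _).
  have [AU cU] := (QP _ _).1 QU; have [AV cV] := (QP _ _).1 QV.
  suff BVU : B (Ud_div V U) by rewrite (mem_set BVU); case: (_ \in _).
  apply: cB => //; rewrite -sum1_card natr_sum mulr_suml ler_sum// => p _.
  by rewrite mul1r (cell_dist h0 (cU p) (cV p)).
apply: (@le_trans _ _ (\sum_q wt q * mean (\1_B))).
  by apply: ler_sum => q _; rewrite meanZ// ler_wpM2l.
rewrite -mulr_suml ler_wpM2r//.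
  by apply: Rintegral_ge0 => U _; rewrite indicE; case: (_ \in _).
(* The two values of the sign bit in each index produce the factor 2. *)
rewrite /wt -(bigA_distr_bigA (fun (_ : P) q => e q)) prodr_const.
rewrite -(pair_bigA _ (fun b i => e (b, i))) big_bool /= -/(\sum_(i < M) _).
by rewrite mulr_natl mulr2n.
Qed.

End CellBound.

(** * Real coordinates of matrices, and unitaries near the identity *)

Section MatrixCoordinates.
Variables (R : realType) (d : nat).
Local Notation Mx := 'M[complex R]_d.
Implicit Types M N X Y : Mx.

Definition reim (b : bool) (z : complex R) : R := if b then complex.Re z else complex.Im z.

Lemma sqF_reim M :
  \sum_(p : 'I_d * 'I_d * bool) reim p.2 (M p.1.1 p.1.2) ^+ 2 = sqF M.
Proof.
rewrite sqFE -(pair_bigA _ (fun p b => reim b (M p.1 p.2) ^+ 2)) /=.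
by apply: eq_bigr => p _; rewrite big_bool.
Qed.

Lemma reimB b z1 z2 : reim b (z1 - z2) = reim b z1 - reim b z2.
Proof. by case: z1 z2 b => [? ?] [? ?] []. Qed.

Lemma reim_sqr_le b z : reim b z ^+ 2 <= sqn z.
Proof. by case: b; [exact: Re_sqr_le|exact: Im_sqr_le]. Qed.

Lemma sqF_mulmx_le M N : sqF (M *m N) <= sqF M * sqF N.
Proof.
rewrite {2 3}/sqF [X in _ * X]exchange_big /= big_distrlr /= /sqF.
apply: ler_sum => i _; apply: ler_sum => j _; rewrite mxE.
exact: sqn_sum_le.
Qed.

Lemma sqF_adj M : sqF (adj M) = sqF M.
Proof.
rewrite /sqF exchange_big; apply: eq_bigr => i _; apply: eq_bigr => j _.
by rewrite mxE sqn_conjc.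
Qed.

Lemma sqF_parallelogram M N : sqF (M + N) + sqF (M - N) = 2 * sqF M + 2 * sqF N.
Proof.
rewrite /sqF !mulr_sumr -!big_split; apply: eq_bigr => i _ /=.
rewrite !mulr_sumr -!big_split; apply: eq_bigr => j _ /=.
by rewrite !mxE sqnB sqnD; ring.
Qed.

Lemma sqFN M : sqF (- M) = sqF M.
Proof.
rewrite /sqF; apply: eq_bigr => i _; apply: eq_bigr => j _.
by rewrite mxE /sqn; case: (M i j) => a b /=; rewrite !sqrrN.
Qed.

(* [M - M^*] is skew-Hermitian, so these [d^2] real numbers determine it. *)
Definition skew_coord (p : 'I_d * 'I_d) M : R :=
  if (p.1 < p.2)%N then complex.Re (M p.1 p.2) - complex.Re (M p.2 p.1)
  else complex.Im (M p.1 p.2) + complex.Im (M p.2 p.1).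

Lemma skew_coordB p M N : skew_coord p (M - N) = skew_coord p M - skew_coord p N.
Proof.
rewrite /skew_coord; case: ifP => _; rewrite !mxE;
  case: (M _ _) (N _ _) (M _ _) (N _ _) => [? ?] [? ?] [? ?] [? ?] /=; ring.
Qed.

Lemma skew_coord_sqr_le p M :
  skew_coord p M ^+ 2 <= 2 * (sqn (M p.1 p.2) + sqn (M p.2 p.1)).
Proof.
rewrite /skew_coord /sqn; case: ifP => _;
  case: (M p.1 p.2) (M p.2 p.1) => [a b] [a' b'] /=;
  have := sqr_ge0 (a + a'); have := sqr_ge0 (b - b');
  have := sqr_ge0 a; have := sqr_ge0 b; have := sqr_ge0 a'; have := sqr_ge0 b'; lra.
Qed.

(** For [i <> j] the quantities [r] and [s] each occur twice in [sqF] and once among the skew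
    coordinates; on the diagonal [r] vanishes. *)
Lemma sqF_skew_le M : sqF (M - adj M) <= 2 * \sum_p skew_coord p M ^+ 2.
Proof.
pose r i j := (complex.Re (M i j) - complex.Re (M j i)) ^+ 2.
pose s i j := (complex.Im (M i j) + complex.Im (M j i)) ^+ 2.
have rC i j : r i j = r j i by rewrite /r -sqrrN opprB.
have sC i j : s i j = s j i by rewrite /s addrC.
have -> : sqF (M - adj M) = \sum_i \sum_j (r i j + s i j).
  apply: eq_bigr => i _; apply: eq_bigr => j _; rewrite !mxE /sqn /r /s.
  by case: (M i j) (M j i) => [? ?] [? ?] /=; rewrite opprK.
have -> : \sum_p skew_coord p M ^+ 2 =
    \sum_(i < d) \sum_(j < d) (if (i < j)%N then r i j else s i j).
  rewrite pair_big; apply: eq_bigr => -[i j] _; rewrite /skew_coord /=.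
  by case: ifP.
rewrite mulr_natl [leRHS]mulr2n [X in _ <= _ + X]exchange_big /= -big_split /=.
apply: ler_sum => i _.
rewrite -big_split /=; apply: ler_sum => j _.
have r0 : 0 <= r i j by exact: sqr_ge0.
have s0 : 0 <= s i j by exact: sqr_ge0.
rewrite (rC j i) (sC j i); case: ltngtP => [ij|ij|/val_inj ij].
- by rewrite addrC.
- by rewrite addrC.
by rewrite {1}/r ij subrr expr0n /= add0r -{1}[s j j]addr0 lerD2l sqr_ge0.
Qed.

(* With [X = U - 1] and [Y = V - 1], unitarity gives [X + X^* = - X X^*], so the
   Hermitian part of [D = X - Y] is dominated by its skew-Hermitian part. *)
Lemma near_identity_skew_le (U V : Ud R d) :
  let D := val U - val V in
  sqF (val U - 1%:M) <= 16^-1 -> sqF (val V - 1%:M) <= 16^-1 ->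
  sqF D <= 8 / 15 * \sum_p skew_coord p D ^+ 2.
Proof.
move=> D hU hV.
have herm (W : Ud R d) : (val W - 1%:M) *m adj (val W - 1%:M) =
    - ((val W - 1%:M) + adj (val W - 1%:M)).
  have -> : adj (val W - 1%:M) = adj (val W) - 1%:M.
    by apply/matrixP => i j; rewrite !mxE rmorphB rmorph_nat eq_sym.
  rewrite mulmxBl !mulmxBr (unitary_adj (valP W)) !mulmx1 mul1mx.
  by rewrite [RHS]opprD !opprB.
(* [X adj X - Y adj Y = X adj D + D adj Y], so the Hermitian part is a small multiple of [D] rather
   than a constant. *)
have DE : D + adj D = - ((val U - 1%:M) *m adj D + D *m adj (val V - 1%:M)).
  set X := val U - 1%:M; set Y := val V - 1%:M.
  have DXY : D = X - Y by rewrite /D /X /Y opprB addrA subrK.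
  have aD : adj D = adj X - adj Y.
    by rewrite DXY; apply/matrixP => i j; rewrite !mxE rmorphB.
  have -> : X *m adj D + D *m adj Y = X *m adj X - Y *m adj Y.
    rewrite aD DXY; apply/matrixP => i j.
    rewrite !mxE -big_split -sumrB /=; apply: eq_bigr => k _; rewrite !mxE; ring.
  have hX : X *m adj X = - (X + adj X) := herm U.
  have hY : Y *m adj Y = - (Y + adj Y) := herm V.
  by rewrite hX hY aD DXY; apply/matrixP => i j; rewrite !mxE; ring.
have E2 : sqF (D + adj D) <= 4^-1 * sqF D.
  rewrite DE sqFN.
  have := sqF_parallelogram ((val U - 1%:M) *m adj D) (D *m adj (val V - 1%:M)).
  have := sqF_ge0 ((val U - 1%:M) *m adj D - D *m adj (val V - 1%:M)).
  have h1 : sqF ((val U - 1%:M) *m adj D) <= 16^-1 * sqF D.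
    by rewrite (le_trans (sqF_mulmx_le _ _))// sqF_adj ler_wpM2r// sqF_ge0.
  have h2 : sqF (D *m adj (val V - 1%:M)) <= sqF D * 16^-1.
    by rewrite (le_trans (sqF_mulmx_le _ _))// sqF_adj ler_wpM2l// sqF_ge0.
  by move: (sqF D) (sqF _) (sqF _) (sqF _) (sqF _) h1 h2 => ? ? ? ? ?; lra.
(* The two squared norms add up to [4 sqF D]. The Hermitian one takes at most [1/4] of [sqF D],
   leaving [15/4 sqF D] below twice the sum of squares; hence [8/15]. *)
have := sqF_parallelogram D (adj D); have := sqF_skew_le D.
rewrite sqF_adj; move: E2; set S := \sum_p _; lra.
Qed.

Lemma sqF1 : sqF (1%:M : Mx) = d%:R.
Proof. by rewrite -[1%:M]/(val (Ud1 R d)) sqF_Ud. Qed.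

Lemma sqn_entry_le1 (U : Ud R d) i j : sqn (val U i j) <= 1.
Proof.
have /matrixP/(_ i i) := unitary_adj (valP U); rewrite !mxE eqxx.
under eq_bigr do rewrite mxE mulrC conjc_mul.
rewrite -rmorph_sum /= => /complexI <-.
by rewrite (bigD1 j)//= lerDl sumr_ge0// => k _; exact: sqn_ge0.
Qed.

End MatrixCoordinates.

(** * Volume doubling and volumes of small balls *)

Section LowerBounds.
Variables (R : realType) (d : nat) (mu : probability (UdM R d) R).
Hypothesis haar : is_haar mu.
Hypothesis d_gt0 : (0 < d)%N.
Local Notation UdM := (UdM R d).
Local Notation mean f := (\int[mu]_x (f x))%R.
Implicit Types (a : R).

(** For [0 <= a <= 1], the unitaries within squared Frobenius distance [2 d a] of the identity after
    a suitable change of phase. *)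
Definition fid_ball a : set UdM := [set U | (1 - a) ^+ 2 <= fid U].

Lemma measurable_fid_ge (c : R) : measurable [set U : UdM | c <= fid U].
Proof.
rewrite (_ : [set U : UdM | _] = setT `&` (@fid R d : UdM -> R) @^-1` [set` `[c, +oo[ ]).
  by apply: measurable_fid.
by apply/seteqP; split => U /=; rewrite in_itv/= andbT => // -[].
Qed.

Lemma measurable_fid_ball a : measurable (fid_ball a).
Proof. exact: measurable_fid_ge. Qed.

Lemma measurable_near_identity : measurable [set U : UdM | sqF (val U - 1%:M) <= 16^-1].
Proof.
have cm := (cmeas_trace R d).1.
rewrite (_ : [set U : UdM | _] = setT `&`
   (fun U : UdM => complex.Re (\tr (val U))) @^-1` [set` `[d%:R - 32^-1, +oo[ ]).
  exact: cm.
apply/seteqP; split => U /=; rewrite in_itv/= andbT sqFB sqF_Ud sqF1 mdot1.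
  by move=> H; split => //; lra.
by case=> _ H; lra.
Qed.

(** Expanding the Frobenius norm bounds [Re (conjc z' z tr (adj V U))] below by [(1 - a) d], and the
    modulus of that number does not see the phases. *)
Lemma fid_ball_div a (z z' : complex R) (U V : Ud R d) : 0 <= a <= 1 ->
  sqn z = 1 -> sqn z' = 1 ->
  sqF (z *: val U - z' *: val V) <= 2 * d%:R * a -> fid_ball a (Ud_div V U).
Proof.
move=> /andP[a0 a1] z1 z1'; have dR : 0 < d%:R :> R by rewrite ltr0n.
rewrite sqFB !sqFZ !sqF_Ud z1 z1' mdotZl mdotZr => H.
rewrite /fid_ball /= /fid trace_Ud_div ler_pdivlMr ?exprn_gt0// -exprMn.
set w := mdot _ _.
have -> : sqn w = sqn (conjc z' * (z * w)) by rewrite !sqnM sqn_conjc z1 z1' !mul1r.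
apply: le_trans (Re_sqr_le _).
rewrite lerXn2r ?nnegrE// ?mulr_ge0 ?subr_ge0//; last by move: H; rewrite -/w; lra.
by apply: le_trans (_ : (1 - a) * d%:R <= _); [rewrite mulr_ge0 ?subr_ge0|move: H; rewrite -/w; lra].
Qed.

Lemma mean_fid_ge a s : 0 <= a <= 1 ->
  (1 - a) ^+ (2 * s) * mean (\1_(fid_ball a)) <= mean (fun U => fid U ^+ s).
Proof.
move=> /andP[a0 a1]; have bB := bmeas_indic (R := R) (measurable_fid_ball a).
rewrite -meanZ//; apply: le_mean; [exact: bmeasZ|exact/bmeasX/bmeas_fid|].
move=> U; rewrite indicE; case: (boolP (U \in _)) => [|_]; last first.
  by rewrite mulr0 exprn_ge0 ?fid_ge0.
by rewrite inE mulr1 exprM => UB; rewrite lerXn2r ?nnegrE ?fid_ge0 ?sqr_ge0.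
Qed.

(** Inverted, this is [(1 - a)^-1 <= 1 + 18/17 a], which holds because [1 - a >= 17/18]. *)
Lemma one_sub_ge_expR a : 0 <= a <= 18^-1 -> expR (- (18 / 17 * a)) <= 1 - a.
Proof.
move=> /andP[a0 a1].
rewrite expRN -[1 - a]invrK lef_pV2 ?posrE ?invr_gt0 ?expR_gt0//; last lra.
apply: le_trans (expR_ge1Dx _); rewrite -[leLHS]mul1r ler_pdivrMr; last lra.
nra.
Qed.

(** Since [(n + 2)^2 >= 4 + 5 n], the terms from index 2 on form at most a geometric series of sum
    [r^4 / (1 - r^5) <= 61/100]; and [1 + 4/5 + 61/100 = 241/100]. *)
Lemma sum_pow_sqr_le (r : R) M : 0 <= r <= 4 / 5 ->
  \sum_(i < M) r ^+ (i * i) <= 241 / 100.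
Proof.
move=> /andP[r0 r45].
have sq n : (4 + 5 * n <= n.+2 * n.+2)%N by nia.
have r1 : r <= 1 by apply: (le_trans r45); lra.
have r4 : r ^+ 4 <= 4096 / 10000.
  by apply: (le_trans (lerXn2r 4 _ _ r45)); rewrite ?nnegrE//; lra.
pose q := r ^+ 5.
have qle : q <= 328 / 1000.
  by apply: (le_trans (lerXn2r 5 _ _ r45)); rewrite ?nnegrE//; lra.
have q0 n : 0 <= q ^+ n by rewrite exprn_ge0// exprn_ge0.
have main n : \sum_(i < n.+2) r ^+ (i * i) <= 1 + r + (61 / 100) * (1 - q ^+ n).
  elim: n => [|n IH].
    by rewrite !big_ord_recr big_ord0 /= expr0 expr1; lra.
  rewrite big_ord_recr /=.
  have : r ^+ (n.+2 * n.+2) <= r ^+ 4 * q ^+ n.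
    by rewrite /q -exprM -exprD ler_wiXn2l.
  have := ler_wpM2r (q0 n) r4; have := ler_wpM2r (q0 n) qle; rewrite [q ^+ n.+1]exprS.
  move: IH (q0 n); clear -r0.
  move: (\sum_(i < _) _) (r ^+ (n.+2 * n.+2)) (r ^+ 4 * _) => S a b.
  by move: (q * q ^+ n) (q ^+ n) => p Q *; lra.
case: M => [|[|n]].
- by rewrite big_ord0; lra.
- by rewrite big_ord1 expr0; lra.
by apply: (le_trans (main n)); move: (q ^+ n) (q0 n) => Q Q0; clear -r45 Q0; lra.
Qed.

Lemma sum_expR_sqr_le M : \sum_(i < M) expR (- (4^-1 * i%:R ^+ 2)) <= 241 / 100 :> R.
Proof.
pose r : R := expR (- 4^-1).
rewrite (eq_bigr (fun i : 'I_M => r ^+ (i * i))); last first.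
  by move=> i _; rewrite /r -expRM_natl natrM; congr expR; ring.
apply: sum_pow_sqr_le; rewrite expR_ge0 /=.
have : expR 4^-1 * r = 1 by rewrite /r expRN mulfV// gt_eqF// expR_gt0.
have : 0 <= r by exact: expR_ge0.
have := expR_ge1Dx (4^-1 : R); rewrite -/r; move: r (expR _) => r e; nra.
Qed.

(* Multiplying [U] by this phase makes its trace real and nonnegative; it is
   [0] when [\tr U = 0]. *)
Definition trace_phase (U : UdM) : complex R :=
  conjc (\tr (val U)) * (powR (sqn (\tr (val U))) (- 2^-1))%:C%C.

Lemma cmeas_trace_phase : cmeas trace_phase.
Proof.
apply: cmeasM; first by apply: cmeas_conjc; exact: cmeas_trace.
apply: cmeas_real; apply: (measurableT_comp (measurable_powR (- 2^-1))).
by apply: measurable_sqn; exact: cmeas_trace.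
Qed.

Lemma sqn_trace_phase (U : UdM) : 0 < fid U ->
  sqn (trace_phase U) = 1 /\
  trace_phase U * \tr (val U) = (d%:R * Num.sqrt (fid U))%:C%C.
Proof.
move=> fU; have t0 : 0 < sqn (\tr (val U)).
  by move: fU; rewrite /fid pmulr_lgt0// invr_gt0 exprn_gt0// ltr0n.
rewrite -sqrt_fid// /trace_phase; set y := sqn _ in t0 *.
have yE : y `^ (- 2^-1) = (Num.sqrt y)^-1 by rewrite powRN powR12_sqrt// ltW.
have sy : 0 < Num.sqrt y by rewrite sqrtr_gt0.
split.
  rewrite sqnM sqn_conjc sqnC -/y yE exprVn sqr_sqrtr ?ltW// mulfV// gt_eqF//.
rewrite mulrAC conjc_mul -/y -rmorphM /= yE; congr (_%:C)%C.
by rewrite -[X in X / _](sqr_sqrtr (ltW t0)) expr2 mulfK// gt_eqF.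
Qed.

(* Gaussian decay of [fid ^ u] at scale [h ~ sqrt (d / u)], in the [2 d^2] real
   coordinates of [U] normalised to have nonnegative trace. *)
Lemma mean_fid_doubling u : 9 * d%:R ^+ 2 <= 2 * u%:R :> R ->
  mean (fun U => fid U ^+ u) <= expR (5 * d%:R ^+ 2) * mean (fun U => fid U ^+ (3 * u)).
Proof.
move=> du; have dR : 0 < d%:R :> R by rewrite ltr0n.
have uR : 0 < u%:R :> R.
  by apply: lt_le_trans (_ : 9 * d%:R ^+ 2 / 2 <= _); [rewrite !mulr_gt0// exprn_gt0|lra].
pose a : R := d%:R ^+ 2 / (4 * u%:R).
have a0 : 0 <= a by rewrite divr_ge0 ?sqr_ge0// mulr_ge0.
have a18 : a <= 18^-1 by rewrite /a ler_pdivrMr; lra.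
(* Chosen so that [2 d^2 h^2 = 2 d a]: a box of side [h] in [2 d^2] coordinates has the size that
   [fid_ball_div] allows for [fid_ball a]. *)
pose h := Num.sqrt (d%:R / (4 * u%:R)) : R.
have h2 : h ^+ 2 = d%:R / (4 * u%:R) by rewrite sqr_sqrtr// divr_ge0// mulr_ge0.
have h0 : 0 < h by rewrite sqrtr_gt0 divr_gt0// mulr_gt0.
pose c (p : 'I_d * 'I_d * bool) (U : UdM) : R :=
  reim p.2 ((trace_phase U *: val U - 1%:M) p.1.1 p.1.2).
have cE U : 0 < fid U -> sqF (trace_phase U *: val U - 1%:M)
    = 2 * d%:R * (1 - Num.sqrt (fid U)).
  move=> fU; have [t1 tt] := sqn_trace_phase fU.
  by rewrite sqFB sqFZ t1 mdotZr mdot1 tt /= sqF_Ud sqF1 mul1r; ring.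
have sf1 U : Num.sqrt (fid U) <= 1 :> R.
  by rewrite -[leRHS]sqrtr1 ler_sqrt// fid_le1.
(* The size of [M] costs nothing, since the Gaussian sum over cells is bounded uniformly in [M]. *)
pose M := (Num.truncn (2 * d%:R / h)).+1.
have Mh : 2 * d%:R < M%:R * h.
  by rewrite -ltr_pdivrMr// /M truncnS_gt.
have := @mean_cell_bound R d mu haar _ c M h 4^-1 [set U | 0 < fid U] (fid_ball a)
  (fun U => fid U ^+ u) h0.
rewrite card_prod card_prod card_ord card_bool.
(* [2 * 241/100 <= (11/10)^17 <= exp (17/10)], raised to the power [2 d^2]. *)
have big : (2 * \sum_(i < M) expR (- (4^-1 * i%:R ^+ 2))) ^+ (d * d * 2)
    <= expR (17 / 5 * d%:R ^+ 2) :> R.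
  have -> : 17 / 5 * d%:R ^+ 2 = (d * d * 2)%:R * (17 / 10) :> R.
    by rewrite !natrM; field.
  rewrite expRM_natl lerXn2r ?nnegrE ?expR_ge0//.
    by rewrite mulr_ge0// sumr_ge0// => i _; exact: expR_ge0.
  have e : (11 / 10) ^+ 17 <= expR (17 / 10) :> R.
    have e10 : 11 / 10 <= expR 10^-1 :> R by apply: le_trans (expR_ge1Dx _); lra.
    by rewrite expRM_natl lerXn2r ?nnegrE ?expR_ge0//; lra.
  have := sum_expR_sqr_le M; move: e; set S := \sum_(i < M) _; lra.
move=> H; have {H} : mean (fun U => fid U ^+ u) <=
    expR (17 / 5 * d%:R ^+ 2) * mean (\1_(fid_ball a)).
  apply: le_trans (ler_wpM2r _ big); last first.
    by apply: Rintegral_ge0 => U _; rewrite indicE; case: (_ \in _).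
  apply: H => //.
  - move=> p; have cm : cmeas (fun U : UdM => (trace_phase U *: val U - 1%:M) p.1.1 p.1.2).
      have -> : (fun U : UdM => (trace_phase U *: val U - 1%:M) p.1.1 p.1.2) =
          fun U : UdM => trace_phase U * val U p.1.1 p.1.2 + (- (1%:M : 'M[complex R]_d) p.1.1 p.1.2).
        by apply/funext => U; rewrite !mxE.
      apply: cmeasD; last exact: cmeas_cst.
      by apply: cmeasM; [exact: cmeas_trace_phase|exact: cmeas_entry].
    by rewrite /c /reim; case: p.2; [exact: cm.1|exact: cm.2].
  - rewrite (_ : [set U : UdM | _] = setT `&` (@fid R d : UdM -> R) @^-1` [set` `]0, +oo[ ]).
      by apply: measurable_fid.
    by apply/seteqP; split => U /=; rewrite in_itv/= andbT => // -[].
  - exact: measurable_fid_ball.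
  - exact/bmeasX/bmeas_fid.
  - move=> U p fU; apply: le_lt_trans Mh.
    rewrite -(@ler_pXn2r _ 2)// ?nnegrE ?mulr_ge0// real_normK ?num_real//.
    apply: (le_trans (reim_sqr_le _ _)); apply: (le_trans (sqn_le_sqF _ _ _)).
    rewrite cE//; have := sqrtr_ge0 (fid U).
    have d1 : 1 <= d%:R :> R by rewrite ler1n.
    move: (Num.sqrt _) => w w0; nra.
  - move=> U V fU fV; have [t1 _] := sqn_trace_phase fU; have [t1' _] := sqn_trace_phase fV.
    under eq_bigr do rewrite -reimB.
    rewrite (eq_bigr (fun p => reim p.2 ((trace_phase U *: val U - trace_phase V *: val V)
      p.1.1 p.1.2) ^+ 2)); last first.
      move=> p _; congr (reim _ _ ^+ 2); rewrite !mxE; ring.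
    rewrite sqF_reim => H; apply: (fid_ball_div _ t1 t1'); first by lra.
    apply: (le_trans H); rewrite h2 /a !natrM le_eqVlt; apply/orP; left; apply/eqP.
    by field; rewrite gt_eqF.
  (* [w^(2u) <= exp (2 u (w - 1))], and the squared distance is [2 d (1 - w)]; with this [h] the
     Gaussian rate is exactly [1/4]. *)
  - move=> U fU.
    have -> : \sum_p (c p U / h) ^+ 2 = sqF (trace_phase U *: val U - 1%:M) / h ^+ 2.
      by rewrite -sqF_reim mulr_suml; apply: eq_bigr => p _; rewrite expr_div_n.
    rewrite cE// h2; set w := Num.sqrt _.
    have -> : fid U = w ^+ 2 by rewrite sqr_sqrtr ?fid_ge0.
    have -> : - (4^-1 * (2 * d%:R * (1 - w) / (d%:R / (4 * u%:R)))) = (2 * u)%:R * (w - 1).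
      by rewrite natrM; field; rewrite !gt_eqF.
    rewrite -exprM expRM_natl lerXn2r ?nnegrE ?sqrtr_ge0 ?expR_ge0//.
    by apply: le_trans (expR_ge1Dx _); lra.
  - move=> U /negP; rewrite -leNgt => fU.
    have -> : fid U = 0 by apply/eqP; rewrite eq_le fU fid_ge0.
    by rewrite expr0n; case: (u) uR => //; rewrite ltxx.
move=> H; apply: (le_trans H).
have /(mean_fid_ge (3 * u)) : 0 <= a <= 1 by lra.
(* The exponent is [6 u * 18/17 * a = 27/17 d^2 <= 8/5 d^2]; together with [17/5] it makes the 5 of
   the statement. *)
have : expR (- (8 / 5 * d%:R ^+ 2)) <= (1 - a) ^+ (2 * (3 * u)).
  apply: (@le_trans _ _ (expR (- (18 / 17 * a)) ^+ (2 * (3 * u)))).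
    rewrite -expRM_natl ler_expR mulnA natrM /a.
    have -> : (2 * 3)%:R * u%:R * - (18 / 17 * (d%:R ^+ 2 / (4 * u%:R))) =
       - (27 / 17 * d%:R ^+ 2) :> R by field; rewrite gt_eqF.
    have := sqr_ge0 (d%:R : R); lra.
  by rewrite lerXn2r ?nnegrE ?expR_ge0 ?one_sub_ge_expR//; lra.
have mB0 : 0 <= mean (\1_(fid_ball a)).
  by apply: Rintegral_ge0 => U _; rewrite indicE; case: (_ \in _).
move=> /(ler_wpM2r mB0) /le_trans h1 /h1 h3.
have -> : 5 * d%:R ^+ 2 = 17 / 5 * d%:R ^+ 2 + 8 / 5 * d%:R ^+ 2 :> R by field.
rewrite expRD -[leRHS]mulrA ler_wpM2l ?expR_ge0// -ler_pdivrMl ?expR_gt0//.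
by rewrite -expRN.
Qed.

(** Pigeonhole over the whole group: a box of side [1 / (6 d)] in [2 d^2] coordinates has squared
    diameter [1/18 < 1/16], so a translate of it lies near the identity. *)
Lemma mean_near_identity_ge :
  1 <= (2 * (6 * d%:R + 1)) ^+ (d * d * 2) *
    mean (\1_[set U : UdM | sqF (val U - 1%:M) <= 16^-1]).
Proof.
have dR : 0 < d%:R :> R by rewrite ltr0n.
pose h : R := (6 * d%:R)^-1.
have h0 : 0 < h by rewrite invr_gt0 mulr_gt0.
have := @mean_cell_bound R d mu haar _
  (fun (p : 'I_d * 'I_d * bool) (U : UdM) => reim p.2 (val U p.1.1 p.1.2))
  (* With [gamma = 0] only the number of boxes matters. The extra cell turns [|entry| <= 1] into the
     strict bound that the covering requires. *)
  (6 * d + 1) h 0 setT [set U | sqF (val U - 1%:M) <= 16^-1] (fun=> 1) h0 (lexx 0).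
rewrite card_prod card_prod card_ord card_bool mean_cst.
under eq_bigr do rewrite mul0r oppr0 expR0.
rewrite sumr_const card_ord -[X in 2 * X]mulr_natr mul1r natrD natrM; apply => //.
- by move=> p; rewrite /reim; case: p.2; [exact: measurable_Ud_Re|exact: measurable_Ud_Im].
- exact: measurable_near_identity.
- exact: bmeas_cst.
- move=> U [[i j] b] _ /=; rewrite mulrDl mul1r /h mulfV; last by rewrite gt_eqF// mulr_gt0.
  apply: (@le_lt_trans _ _ 1); last by rewrite ltrDl.
  rewrite -(@ler_pXn2r _ 2)// ?nnegrE// real_normK ?num_real// expr1n.
  exact: (le_trans (reim_sqr_le _ _) (sqn_entry_le1 _ _ _)).
- move=> U V _ _; under eq_bigr do rewrite -reimB.
  rewrite (eq_bigr (fun p => reim p.2 ((val U - val V) p.1.1 p.1.2) ^+ 2)); last first.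
    by move=> p _; rewrite !mxE.
  rewrite sqF_reim /= sqF_Ud_div => /le_trans; apply.
  rewrite /h !natrM exprVn exprMn.
  have -> : d%:R * d%:R * 2 / (6 ^+ 2 * d%:R ^+ 2) = 18^-1 :> R by field; rewrite gt_eqF.
  lra.
- by move=> U _; rewrite mul0r oppr0 expR0.
- by move=> U /(_ I).
Qed.

(* Only the [d^2] skew-Hermitian coordinates are subdivided here, whence the
   exponent [d * d] instead of [d * d * 2]. *)
Lemma mean_near_identity_le m : (0 < m)%N -> d%:R <= 15 * m%:R ^+ 2 :> R ->
  mean (\1_[set U : UdM | sqF (val U - 1%:M) <= 16^-1]) <=
  (2 * (m%:R + 1)) ^+ (d * d) * mean (\1_(fid_ball (d%:R / (15 * m%:R ^+ 2)))).
Proof.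
move=> m0 dm; have mR : 0 < m%:R :> R by rewrite ltr0n.
(* Then [8/15 d^2 h^2 = 2 d a] for the [a] below, which links [near_identity_skew_le] to
   [fid_ball_div]. *)
pose h : R := (2 * m%:R)^-1.
have h0 : 0 < h by rewrite invr_gt0 mulr_gt0.
set A := [set U : UdM | _]; set a := _ / (15 * _).
have a01 : 0 <= a <= 1.
  rewrite /a divr_ge0 ?mulr_ge0 ?sqr_ge0//= ler_pdivrMr ?mul1r//.
  by rewrite mulr_gt0// exprn_gt0.
have mA : measurable A by exact: measurable_near_identity.
have := @mean_cell_bound R d mu haar _
  (fun (p : 'I_d * 'I_d) (U : UdM) => skew_coord p (val U))
  (m + 1) h 0 A (fid_ball a) (\1_A) h0 (lexx 0).
rewrite card_prod card_ord.
under eq_bigr do rewrite mul0r oppr0 expR0.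
rewrite sumr_const card_ord -[X in 2 * X]mulr_natr mul1r natrD; apply => //.
- move=> p; rewrite /skew_coord; case: (ltnP p.1 p.2) => _.
    by apply: measurable_funB; exact: measurable_Ud_Re.
  by apply: measurable_funD; exact: measurable_Ud_Im.
- exact: measurable_fid_ball.
- exact: bmeas_indic.
- move=> U p AU; rewrite mulrDl mul1r.
  have -> : m%:R * h = 2^-1 by rewrite /h; field; rewrite gt_eqF.
  apply: (@le_lt_trans _ _ 2^-1); last by rewrite ltrDl.
  rewrite -(@ler_pXn2r _ 2)// ?nnegrE// real_normK ?num_real//.
  (* The identity is Hermitian, so its skew coordinates vanish. *)
  have -> : skew_coord p (val U) = skew_coord p (val U - 1%:M).
    rewrite skew_coordB /skew_coord; case: (ltnP p.1 p.2) => pp.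
      have np : (p.1 == p.2) = false.
        by apply/negbTE; apply: contraTneq pp => ->; rewrite ltnn.
      by rewrite !mxE [p.2 == p.1]eq_sym np /= !subr0.
    rewrite !mxE; case: (val U p.1 p.2) (val U p.2 p.1) => [x y] [x' y'].
    by case: (p.1 == p.2); case: (p.2 == p.1); rewrite /= !addr0 ?oppr0 ?subr0 ?addr0.
  apply: (le_trans (skew_coord_sqr_le _ _)).
  have := sqn_le_sqF (val U - 1%:M) p.1 p.2; have := sqn_le_sqF (val U - 1%:M) p.2 p.1.
  move: AU; rewrite /A /=; lra.
- move=> U V AU AV; under eq_bigr do rewrite -skew_coordB.
  move=> H; apply: (@fid_ball_div a 1 1) => //; [by rewrite /sqn/=; ring|by rewrite /sqn/=; ring|].
  rewrite !scale1r; apply: (le_trans (near_identity_skew_le AU AV)).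
  apply: (@le_trans _ _ (8 / 15 * ((d * d)%:R * h ^+ 2))); first by rewrite ler_wpM2l.
  rewrite /h /a natrM le_eqVlt; apply/orP; left; apply/eqP.
  by field; rewrite gt_eqF.
- by move=> U AU; rewrite indicE mem_set// mul0r oppr0 expR0.
- by move=> U AU; rewrite indicE memNset.
Qed.

End LowerBounds.

(** * Moments of the trace *)

Section MonomialBound.
Variables (R : realType) (d : nat) (mu : probability (UdM R d) R).
Hypothesis haar : is_haar mu.
Hypothesis d_gt0 : (0 < d)%N.
Variable s : nat.
Local Notation UdM := (UdM R d).
Local Notation C := (complex R).
Local Notation mean f := (\int[mu]_x (f x))%R.
Local Notation P := ('I_d * 'I_d)%type.
Local Notation word := {ffun 'I_s -> P}.
Implicit Types (f g : word) (U V : UdM).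

Definition monom f U : C := \prod_a val U (f a).1 (f a).2.
Definition monom2 f g U : C := conjc (monom f U) * monom g U.

Lemma cmeas_monom2 f g : cmeas (monom2 f g).
Proof.
by apply: cmeasM; [apply: cmeas_conjc|]; apply: cmeas_prod => a; exact: cmeas_entry.
Qed.

Lemma sqn_prod (I : finType) (F : I -> C) : sqn (\prod_i F i) = \prod_i sqn (F i).
Proof.
apply: (big_morph (@sqn R)); first exact: sqnM.
by rewrite /sqn /= expr1n expr0n addr0.
Qed.

Lemma sqn_monom f U : sqn (monom f U) = \prod_a sqn (val U (f a).1 (f a).2).
Proof. exact: sqn_prod. Qed.

Lemma sqn_monom_le1 f U : sqn (monom f U) <= 1.
Proof.
rewrite sqn_monom; apply: prodr_ile1 => a _.
by rewrite sqn_ge0 sqn_entry_le1.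
Qed.

Lemma sqn_monom2_le1 f g U : sqn (monom2 f g U) <= 1.
Proof.
rewrite sqnM sqn_conjc mulr_ile1// ?sqn_ge0// ?sqn_monom_le1//.
Qed.

Lemma bmeas_Re_monom2 f g : bmeas (fun U => complex.Re (monom2 f g U)).
Proof.
split; first exact: (cmeas_monom2 f g).1.
exists 1 => U; rewrite -(@ler_pXn2r _ 2)// ?nnegrE// real_normK ?num_real// expr1n.
exact: (le_trans (Re_sqr_le _) (sqn_monom2_le1 _ _ _)).
Qed.

Lemma bmeas_Im_monom2 f g : bmeas (fun U => complex.Im (monom2 f g U)).
Proof.
split; first exact: (cmeas_monom2 f g).2.
exists 1 => U; rewrite -(@ler_pXn2r _ 2)// ?nnegrE// real_normK ?num_real// expr1n.
exact: (le_trans (Im_sqr_le _) (sqn_monom2_le1 _ _ _)).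
Qed.

Lemma mdot_expn U V :
  mdot (val V) (val U) ^+ s = \sum_f conjc (monom f V) * monom f U.
Proof.
rewrite /mdot pair_big /= -[X in _ ^+ X]card_ord -prodr_const bigA_distr_bigA /=.
by apply: eq_bigr => f _; rewrite /monom rmorph_prod -big_split.
Qed.

Lemma sqn_mdot_expn U V : sqn (mdot (val V) (val U)) ^+ s =
  \sum_f \sum_g (complex.Re (monom2 f g V) * complex.Re (monom2 f g U) +
                 complex.Im (monom2 f g V) * complex.Im (monom2 f g U)).
Proof.
have sX (z : C) : sqn z ^+ s = sqn (z ^+ s).
  elim: (s) => [|n IH]; first by rewrite /sqn /= expr1n expr0n addr0.
  by rewrite !exprS sqnM IH.
rewrite sX mdot_expn; set z := (X in sqn X).
have -> : sqn z = complex.Re (conjc z * z) by rewrite conjc_mul.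
rewrite {1}/z rmorph_sum mulr_suml Re_sum; apply: eq_bigr => f _.
rewrite mulr_sumr Re_sum; apply: eq_bigr => g _.
rewrite /monom2.
move: (monom f V) (monom f U) (monom g V) (monom g U) => [? ?] [? ?] [? ?] [? ?] /=; ring.
Qed.

(* By invariance [|tr U|^2s] may be replaced by [|tr (V^* U)|^2s] for every [V];
   averaging over [V] as well leaves a sum of squares. *)
Lemma mean_trace_expn : mean (fun U => sqn (\tr (val U)) ^+ s) =
  \sum_f \sum_g (mean (fun U => complex.Re (monom2 f g U)) ^+ 2 +
                 mean (fun U => complex.Im (monom2 f g U)) ^+ 2).
Proof.
set J := mean _.
have bt : bmeas (fun U : UdM => sqn (\tr (val U)) ^+ s).
  have -> : (fun U : UdM => sqn (\tr (val U)) ^+ s) =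
      fun U => (d%:R ^+ 2) ^+ s * fid U ^+ s.
    by apply/funext => U; rewrite -exprMn /fid mulrC divfK// expf_neq0// pnatr_eq0 -lt0n.
  exact/bmeasZ/bmeasX/bmeas_fid.
have JV V : J = \sum_f \sum_g
    (complex.Re (monom2 f g V) * mean (fun U => complex.Re (monom2 f g U)) +
     complex.Im (monom2 f g V) * mean (fun U => complex.Im (monom2 f g U))).
  rewrite /J -(mean_Ud_mul haar (Ud_adj V) bt).
  transitivity (mean (fun U => sqn (mdot (val V) (val U)) ^+ s)).
    by apply: eq_Rintegral => U _; rewrite -[Ud_mul _ _]/(Ud_div V U) trace_Ud_div.
  under eq_Rintegral do rewrite sqn_mdot_expn.
  have b1 f g : bmeas (fun U => complex.Re (monom2 f g V) * complex.Re (monom2 f g U)).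
    exact/bmeasZ/bmeas_Re_monom2.
  have b2 f g : bmeas (fun U => complex.Im (monom2 f g V) * complex.Im (monom2 f g U)).
    exact/bmeasZ/bmeas_Im_monom2.
  rewrite mean_sum => [|f _]; last first.
    by apply: bmeas_sum => g _; exact: bmeasD.
  apply: eq_bigr => f _; rewrite mean_sum => [|g _]; last exact: bmeasD.
  apply: eq_bigr => g _; rewrite meanD//.
  by rewrite !meanZ//; [exact: bmeas_Im_monom2|exact: bmeas_Re_monom2].
have -> : J = mean (fun V => J) by rewrite mean_cst.
under eq_Rintegral => V _ do rewrite (JV V).
pose cR f g := mean (fun U => complex.Re (monom2 f g U)).
pose cI f g := mean (fun U => complex.Im (monom2 f g U)).
have b1 f g : bmeas (fun V => complex.Re (monom2 f g V) * cR f g).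
  by apply: bmeasM; [exact: bmeas_Re_monom2|exact: bmeas_cst].
have b2 f g : bmeas (fun V => complex.Im (monom2 f g V) * cI f g).
  by apply: bmeasM; [exact: bmeas_Im_monom2|exact: bmeas_cst].
rewrite mean_sum => [|f _]; last first.
  by apply: bmeas_sum => g _; exact: bmeasD.
apply: eq_bigr => f _; rewrite mean_sum => [|g _]; last exact: bmeasD.
apply: eq_bigr => g _; rewrite meanD// -/(cR f g) -/(cI f g).
under eq_Rintegral do rewrite mulrC.
under [X in _ + X]eq_Rintegral do rewrite mulrC.
by rewrite !meanZ ?expr2//; [exact: bmeas_Im_monom2|exact: bmeas_Re_monom2].
Qed.

Let n := (d * d).-1.
Let p0 : P := (Ordinal d_gt0, Ordinal d_gt0).

Definition letter_count f (p : P) := #|[pred a | f a == p]|.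
(** A multiset of matrix entries, encoded as a tuple of length [d * d = n.+1]: the form in which
    compositions of [s] are counted by a binomial. [inord] loses nothing, as no count exceeds
    [s]. *)
Definition letter_counts f : n.+1.-tuple 'I_s.+1 :=
  [tuple inord (letter_count f (nth p0 (enum {: P}) i)) | i < n.+1].

Lemma letter_count_le f p : (letter_count f p < s.+1)%N.
Proof. by rewrite ltnS -[X in (_ <= X)%N]card_ord max_card. Qed.

Lemma size_enumP : size (enum {: P}) = n.+1.
Proof. by rewrite -cardE card_prod card_ord prednK// muln_gt0 d_gt0. Qed.

Lemma letter_countsP f g : letter_counts f = letter_counts g -> letter_count f =1 letter_count g.
Proof.
move=> fg p; have pin : p \in enum {: P} by rewrite mem_enum.
have hi : (index p (enum {: P}) < n.+1)%N by rewrite -size_enumP index_mem.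
have := congr1 (fun t => val (tnth t (Ordinal hi))) fg.
by rewrite !tnth_mktuple /= nth_index// !inordK ?letter_count_le.
Qed.

Lemma eq_monom f g U : letter_counts f = letter_counts g -> monom f U = monom g U.
Proof.
move=> /letter_countsP fg.
have mE h : monom h U = \prod_(p : P) val U p.1 p.2 ^+ letter_count h p.
  rewrite /monom (partition_big h predT)//=; apply: eq_bigr => p _.
  rewrite (eq_bigr (fun _ => val U p.1 p.2)); last by move=> a /eqP ->.
  by rewrite prodr_const.
by rewrite !mE; apply: eq_bigr => p _; rewrite fg.
Qed.

Lemma card_letter_counts : (#|codom letter_counts| <= 'C(n + s, n))%N.
Proof.
rewrite -(card_ord_partitions n s); apply: subset_leq_card; apply/fintype.subsetP => t.
case/codomP => f ->; rewrite inE /letter_counts; apply/eqP.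
rewrite big_tuple; under eq_bigr do rewrite tnth_mktuple inordK ?letter_count_le//.
transitivity (\sum_(p <- enum {: P}) letter_count f p)%N.
  by rewrite (big_nth p0) size_enumP big_mkord.
rewrite big_enum /= -[RHS]card_ord -sum1_card (partition_big f predT)//=.
by apply: eq_bigr => p _; rewrite /letter_count -sum1_card; apply: eq_bigl.
Qed.

(* In the expansion of the moment only the pairs of words using the same letters
   with the same multiplicities are kept; as there are at most ['C(n + s, n)]
   multisets of letters, the bound is Cauchy-Schwarz. *)
Lemma mean_fid_ge_binomial : ('C(n + s, n)%:R)^-1 <= mean (fun U => fid U ^+ s).
Proof.
have dR : 0 < d%:R :> R by rewrite ltr0n.
pose G f := mean (fun U => sqn (monom f U)).
have G0 f : 0 <= G f by apply: Rintegral_ge0 => U _; exact: sqn_ge0.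
have bG f : bmeas (fun U => sqn (monom f U)).
  have -> : (fun U => sqn (monom f U)) = fun U => complex.Re (monom2 f f U).
    by apply/funext => U; rewrite /monom2 conjc_mul.
  exact: bmeas_Re_monom2.
have GE f g : letter_counts f = letter_counts g -> mean (fun U => complex.Re (monom2 f g U)) = G f.
  by move=> fg; apply: eq_Rintegral => U _; rewrite /monom2 -(eq_monom U fg) conjc_mul.
have GC f g : letter_counts f = letter_counts g -> G f = G g.
  by move=> fg; apply: eq_Rintegral => U _; rewrite (eq_monom U fg).
(* Pointwise, the sum over all words is the [s]-th power of [sqF U = d]. *)
have sumG : \sum_f G f = d%:R ^+ s.
  rewrite /G -mean_sum; last by move=> f _; exact: bG.
  rewrite -[RHS](mean_cst mu); apply: eq_Rintegral => U _.
  rewrite -(sqF_Ud U) sqFE -[X in _ ^+ X]card_ord -prodr_const bigA_distr_bigA /=.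
  by apply: eq_bigr => f _; rewrite sqn_monom.
pose T := codom letter_counts.
pose H t := \sum_(f | letter_counts f == t) G f.
have sumH : \sum_(t in T) H t = d%:R ^+ s.
  rewrite -sumG [RHS](partition_big letter_counts (mem T))//=.
  by move=> f _; exact: codom_f.
have D0 : (0 < #|T|)%N.
  by apply/card_gt0P; exists (letter_counts [ffun=> p0]); exact: codom_f.
have DR : 0 < #|T|%:R :> R by rewrite ltr0n.
have J_ge : \sum_(t in T) H t ^+ 2 <= mean (fun U => sqn (\tr (val U)) ^+ s).
  rewrite mean_trace_expn [leRHS](partition_big letter_counts (mem T))/=; last first.
    by move=> f _; exact: codom_f.
  (* Within a class the mean of [Re (monom2 f g)] is [G f = G g], so its square is [G f * G g]; all
     discarded terms are squares. *)
  apply: ler_sum => t _; rewrite expr2 /H mulr_suml; apply: ler_sum => f /eqP ft.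
  rewrite mulr_sumr [leRHS](bigID (fun g => letter_counts g == t)) /=.
  rewrite -[leLHS]addr0 lerD//; last first.
    by apply: sumr_ge0 => g _; rewrite addr_ge0// sqr_ge0.
  apply: ler_sum => g /eqP gt.
  rewrite GE ?ft ?gt// (GC g f) ?ft ?gt// -expr2 lerDl sqr_ge0//.
have CS : d%:R ^+ s ^+ 2 <= #|T|%:R * \sum_(t in T) H t ^+ 2.
  (* [l] is the average of [H] over [T], so the sum below is a variance. *)
  pose l := d%:R ^+ s / #|T|%:R : R.
  have : 0 <= \sum_(t in T) (H t - l) ^+ 2 by apply: sumr_ge0 => t _; exact: sqr_ge0.
  have -> : \sum_(t in T) (H t - l) ^+ 2 = \sum_(t in T) H t ^+ 2 - #|T|%:R * l ^+ 2.
    rewrite (eq_bigr (fun t => H t ^+ 2 + (- 2 * l) * H t + l ^+ 2)); last first.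
      by move=> t _; ring.
    rewrite !big_split /= -mulr_sumr sumH sumr_const -[_ *+ #|_|]mulr_natl.
    by rewrite /l; field; rewrite gt_eqF.
  rewrite subr_ge0 => /(ler_wpM2l (ltW DR)).
  have -> // : #|T|%:R * (#|T|%:R * l ^+ 2) = d%:R ^+ s ^+ 2.
  by rewrite /l; field; rewrite gt_eqF.
have TC : #|T|%:R <= 'C(n + s, n)%:R :> R by rewrite ler_nat card_letter_counts.
have CR : 0 < 'C(n + s, n)%:R :> R by apply: lt_le_trans TC.
have JE : mean (fun U => sqn (\tr (val U)) ^+ s) =
    (d%:R ^+ s ^+ 2) * mean (fun U => fid U ^+ s).
  rewrite -meanZ; last exact/bmeasX/bmeas_fid.
  apply: eq_Rintegral => U _; rewrite /fid expr_div_n -!exprM mulrC mulnC divfK//.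
  by rewrite expf_neq0// gt_eqF.
have ds : 0 < d%:R ^+ s ^+ 2 :> R by rewrite !exprn_gt0.
rewrite -div1r ler_pdivrMr// mulrC.
apply: (@le_trans _ _ (#|T|%:R * mean (fun U => fid U ^+ s))); last first.
  by rewrite ler_wpM2r//; apply: Rintegral_ge0 => U _; rewrite exprn_ge0// fid_ge0.
rewrite -(ler_pM2l ds) mulr1 mulrCA -JE (le_trans CS)// ler_pM2l//.
Qed.

End MonomialBound.

(** * Numerical estimates *)

Section Numerics.
Variable R : realType.
Implicit Types (x : R) (d n s : nat).

Lemma sin_le_id x : 0 <= x -> sin x <= x.
Proof.
move=> x0.
have [c _] : exists2 c, c \in `[0, x] & sin x - sin 0 = cos c * (x - 0).
  by apply: MVT_segment => //; apply: continuous_subspaceT; exact: continuous_sin.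
rewrite sin0 !subr0 => ->; rewrite -[leRHS]mul1r ler_wpM2r// cos_le1//.
Qed.

(** From [sin (pi / 4) <= pi / 4] and [sin (pi / 4)^2 = 1/2]. *)
Lemma pihalf_ge : 7 / 5 <= pi / 2 :> R.
Proof.
have p0 := pi_gt0 R.
pose y : R := pi / 2 / 2.
have y0 : 0 <= y by rewrite /y; lra.
have := cos_pihalf R.
have -> : pi / 2 = y *+ 2 :> R by rewrite /y mulr2n; field.
rewrite cos_mulr2n cos2sin2 => cy.
have sy := sin_le_id y0.
have s2 : sin y ^+ 2 = 2^-1 by move: cy; rewrite -mulr_natl => cy; lra.
have s0 : 0 <= sin y by apply: sin_ge0_pi; apply/andP; split => //; rewrite /y; lra.
have : 2^-1 <= y ^+ 2 by rewrite -s2 lerXn2r ?nnegrE.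
rewrite -mulr_natl; nra.
Qed.

(** If [E < d^2], then [36 d <= E] forces [d > 36], and [pi / 2 >= 7/5 >= exp (3/10)] makes the
    power of [pi / 2] at least [exp (3/10 d (d - 1)) >= exp (E / 4)]: the bound would be at least
    9. *)
Lemma sqr_le_of_trivial_bound_fails d (E : R) : 36 * d%:R <= E ->
  9 * expR (- (E / 4)) * (pi / 2) ^+ (d * (d - 1)) < 1 -> d%:R ^+ 2 <= E.
Proof.
move=> E36 h; rewrite leNgt; apply/negP => Ed.
have d37 : (36 < d)%N.
  rewrite -(ltr_nat R); have : 0 <= d%:R :> R by [].
  move=> dR; rewrite ltNge; apply/negP => d36; nra.
have e75 : expR (3 / 10) <= 7 / 5 :> R.
  have e1 : 9 / 10 <= expR (- 10^-1) :> R by apply: le_trans (expR_ge1Dx _); lra.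
  rewrite expRM_natl.
  have : expR (10^-1) * expR (- 10^-1) = 1 :> R by rewrite -expRD subrr expR0.
  have : 0 < expR (10^-1) :> R by exact: expR_gt0.
  move: (expR (10^-1)) (expR (- 10^-1)) e1 => a b b9 a0 ab.
  have a1 : a <= 10 / 9 by nra.
  apply: le_trans (_ : (10 / 9) ^+ 3 <= _); last lra.
  by rewrite lerXn2r// nnegrE; lra.
have : expR (3 / 10 * (d * (d - 1))%:R) <= (pi / 2) ^+ (d * (d - 1)) :> R.
  rewrite mulrC expRM_natl lerXn2r ?nnegrE ?expR_ge0 ?(le_trans e75) ?pihalf_ge//.
  by have := pi_ge0 R; lra.
move=> h2; have : 9 * expR (- (E / 4)) * expR (3 / 10 * (d * (d - 1))%:R) < 1.
  by apply: le_lt_trans h; rewrite ler_wpM2l// mulr_ge0// expR_ge0.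
apply/negP; rewrite -leNgt -mulrA -expRD.
have : 1 <= expR (- (E / 4) + 3 / 10 * (d * (d - 1))%:R).
  rewrite -[leLHS]expR0 ler_expR natrM natrB; last by case: (d) d37.
  have dR : 36 <= d%:R :> R by rewrite ler_nat ltnW.
  nra.
lra.
Qed.

Lemma expn_fact_le n : (0 < n)%N -> n%:R ^+ n / n`!%:R <= expR n%:R :> R.
Proof.
case: n => // n _; apply: le_trans (expR_ge1Dxn n _) => //.
by rewrite lerDr.
Qed.

Lemma ffact_le_expn m n : (m ^_ n <= m ^ n)%N.
Proof.
rewrite ffact_prod -[X in (_ <= _ ^ X)%N]card_ord -prod_nat_const.
by apply: leq_prod => i _; exact: leq_subr.
Qed.

Lemma binomial_le_expR n s : (0 < n)%N ->
  'C(n + s, n)%:R <= ((n + s)%:R / n%:R) ^+ n * expR n%:R :> R.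
Proof.
move=> n0; have nR : 0 < n%:R :> R by rewrite ltr0n.
have fR : 0 < n`!%:R :> R by rewrite ltr0n fact_gt0.
apply: (@le_trans _ _ ((n + s)%:R ^+ n / n`!%:R)).
  by rewrite ler_pdivlMr// -natrX -natrM ler_nat bin_ffact ffact_le_expn.
apply: (@le_trans _ _ (((n + s)%:R / n%:R) ^+ n * (n%:R ^+ n / n`!%:R))).
  by rewrite mulrA -exprMn divfK// gt_eqF.
by rewrite ler_wpM2l ?expn_fact_le// exprn_ge0// divr_ge0.
Qed.

Lemma expR1_le : expR 1 <= 282 / 100 :> R.
Proof.
have e1 : 15 / 16 <= expR (- 16^-1) :> R by apply: le_trans (expR_ge1Dx _); lra.
have -> : 1 = 16%:R * 16^-1 :> R by lra.
rewrite expRM_natl.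
have : expR (16^-1) * expR (- 16^-1) = 1 :> R by rewrite -expRD subrr expR0.
have : 0 < expR (16^-1) :> R by exact: expR_gt0.
move: (expR (16^-1)) (expR (- 16^-1)) e1 => a b b9 a0 ab.
have a1 : a <= 16 / 15 by nra.
apply: le_trans (_ : (16 / 15) ^+ 16 <= _); last lra.
by rewrite lerXn2r// nnegrE; lra.
Qed.

Lemma cube_le_pow4 n : 1200 * (n + 8)%:R ^+ 3 <= 4 ^+ (n + 10) :> R.
Proof.
elim: n => [|n IH]; first by rewrite !add0n; lra.
rewrite !addSn [4 ^+ _.+1]exprS -[(n + 8).+1]addn1 natrD.
have : 8 <= (n + 8)%:R :> R by rewrite ler_nat leq_addl.
move: IH; move: (n + 8)%:R (4 ^+ _) => D P IH D8.
have : (D + 1) ^+ 3 <= 4 * D ^+ 3 by nra.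
lra.
Qed.

(** Pays for the excess [q^(d - 2)] of the counting bound. For [d >= 8], [1200 d^3 <= 4^(d + 2)] and
    [(d + 2) (d - 2) <= d^2]; smaller [d] are computed. *)
Lemma moderate_range_numeric d : (3 <= d)%N ->
  282 / 100 * (1200 * d%:R ^+ 3) ^+ (d - 2) <= 32 * 4 ^+ (d * d) :> R.
Proof.
case: d => [|[|[|[|[|[|[|[|n]]]]]]]]// _; rewrite ?subSS ?subn0.
- by rewrite -[(3 * 3)%N]/9%N; lra.
- by rewrite -[(4 * 4)%N]/16%N; lra.
- by rewrite -[(5 * 5)%N]/25%N; lra.
- by rewrite -[(6 * 6)%N]/36%N; lra.
- by rewrite -[(7 * 7)%N]/49%N; lra.
have h := cube_le_pow4 n; rewrite -[n.+4.+4]/(8 + n)%N addnC.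
apply: (@le_trans _ _ (282 / 100 * (4 ^+ (n + 10)) ^+ (n + 6))).
  apply: ler_wpM2l; first by lra.
  rewrite -[n.+3.+3]/(6 + n)%N (addnC 6).
  have X0 : 0 <= 1200 * (n + 8)%:R ^+ 3 :> R.
    by apply: mulr_ge0; [exact: ler0n|apply: exprn_ge0; exact: ler0n].
  by apply: lerXn2r; rewrite // nnegrE (le_trans X0).
rewrite -exprM.
have : 4 ^+ ((n + 10) * (n + 6)) <= 4 ^+ ((n + 8) * (n + 8)) :> R.
  by rewrite ler_weXn2l//; [lra|nia].
have : 0 <= 4 ^+ ((n + 10) * (n + 6)) :> R by rewrite exprn_ge0.
lra.
Qed.

(** The square of [(51 d^(5/2))^d <= (1200 d^3)^(d - 1)]. For [d >= 6] one factor [2601 d^5] is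
    spread as [(553 d)^(d - 1)] over the others, and [553 * 2601 <= 1200^2]. *)
Lemma large_range_numeric d : (3 <= d)%N ->
  (2601 * d%:R ^+ 5) ^+ d <= ((1200 * d%:R ^+ 3) ^+ 2) ^+ (d - 1) :> R.
Proof.
case: d => [|[|[|[|[|[|n]]]]]]// _; rewrite ?subSS ?subn0; [lra|lra|lra|].
set D := n.+4.+2%:R : R; have D1 : 1 <= D by rewrite ler1n.
have D0 : 0 <= D by exact: ler0n.
rewrite exprS.
apply: (@le_trans _ _ ((553 ^+ n.+4.+1 * D ^+ n.+4.+1) * (2601 * D ^+ 5) ^+ n.+4.+1)).
  apply: ler_wpM2r; first by apply: exprn_ge0; apply: mulr_ge0; [exact: ler0n|exact: exprn_ge0].
  apply: ler_pM; [exact: ler0n|exact: exprn_ge0| |exact: ler_weXn2l].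
  apply: (@le_trans _ _ (553 ^+ 2)); first by clear; lra.
  by apply: ler_weXn2l => //; clear; lra.
rewrite -!exprMn; apply: lerXn2r; rewrite ?nnegrE.
- by apply: mulr_ge0; apply: mulr_ge0; [exact: ler0n|exact: D0|exact: ler0n|exact: exprn_ge0].
- by apply: exprn_ge0; apply: mulr_ge0; [exact: ler0n|exact: exprn_ge0].
have : 0 <= D ^+ 6 by exact: exprn_ge0.
have -> : 553 * D * (2601 * D ^+ 5) = 553 * 2601 * D ^+ 6 by ring.
have -> : (1200 * D ^+ 3) ^+ 2 = 1200 * 1200 * D ^+ 6 by ring.
by move: (D ^+ 6) => X; lra.
Qed.

End Numerics.

(** * Lower bounds for the mean of a power of the fidelity *)

Local Notation mean mu f := (\int[mu]_x (f x))%R.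

Lemma mean_fid_ge0 (R : realType) d (mu : probability (UdM R d) R) s :
  0 <= mean mu (fun U => fid U ^+ s).
Proof. by apply: Rintegral_ge0 => U _; rewrite exprn_ge0// fid_ge0. Qed.

(** The binomial is at most [(e (n + s) / n)^n]; replacing the denominator [n] by [d^2 = n + 1]
    costs [(1 + 1/n)^n <= e], the leading [282/100]. *)
Lemma binomial_dim_le (R : realType) (d s : nat) (q c : R) :
  36 * d%:R <= q ^+ 2 ->
  s%:R <= d%:R * q ^+ 2 * (2 / 5 + 5 / 24 * d%:R) ->
  (2 <= d)%N -> 0 <= c ->
  282 / 100 * (77 / 180 / d%:R + 5 / 24) <= c ->
  'C((d * d).-1 + s, (d * d).-1)%:R <= 282 / 100 * (c * q ^+ 2) ^+ (d * d).-1 :> R.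
Proof.
move=> q_ge s_le d2 c0 hc; set n := (d * d).-1.
have dd : (d * d = n.+1)%N by rewrite /n prednK// muln_gt0 (ltnW d2).
have n0 : (0 < n)%N by rewrite -ltnS -dd (leq_trans _ (leq_mul d2 d2)).
have nR : 0 < n%:R :> R by rewrite ltr0n.
have DR : 2 <= d%:R :> R by rewrite ler_nat.
have D0 : 0 < d%:R :> R by apply: lt_le_trans DR.
have D2 : d%:R ^+ 2 = n%:R + 1 :> R by rewrite expr2 -natrM dd -natr1.
apply: (le_trans (binomial_le_expR R s n0)).
have -> : expR n%:R = expR 1 ^+ n :> R by rewrite -expRM_natl mulr1.
have e0 : 0 <= expR 1 :> R by exact: expR_ge0.
have e1 := expR1_le R.
have split_pow : ((n + s)%:R / n%:R) ^+ n * expR 1 ^+ n =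
    (1 + n%:R^-1) ^+ n * (expR 1 * ((n + s)%:R / d%:R ^+ 2)) ^+ n :> R.
  rewrite -!exprMn D2; congr (_ ^+ n); field.
  by rewrite !gt_eqF// addr_gt0.
rewrite split_pow; apply: ler_pM.
- by rewrite exprn_ge0// addr_ge0// invr_ge0 ltW.
- by rewrite exprn_ge0// mulr_ge0// divr_ge0// sqr_ge0.
- apply: le_trans e1; apply: (@le_trans _ _ (expR n%:R^-1 ^+ n)).
    by apply: lerXn2r; rewrite ?nnegrE ?expR_ge0 ?expR_ge1Dx.
  by rewrite -expRM_natl mulfV// gt_eqF.
apply: lerXn2r; rewrite ?nnegrE.
- by rewrite mulr_ge0// divr_ge0// sqr_ge0.
- by rewrite mulr_ge0// sqr_ge0.
(* [77/180 = 2/5 + 1/36], where [1/36] comes from [n <= d^2 <= d q^2 / 36]. *)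
have ns : (n + s)%:R / d%:R ^+ 2 <= q ^+ 2 * (77 / 180 / d%:R + 5 / 24).
  rewrite ler_pdivrMr ?exprn_gt0// natrD.
  have -> : q ^+ 2 * (77 / 180 / d%:R + 5 / 24) * d%:R ^+ 2 =
     77 / 180 * (d%:R * q ^+ 2) + 5 / 24 * d%:R * (d%:R * q ^+ 2).
    by field; rewrite gt_eqF.
  have : n%:R <= d%:R * q ^+ 2 / 36.
    have : 36 * d%:R * d%:R <= q ^+ 2 * d%:R by rewrite ler_wpM2r// ltW.
    by move: D2; rewrite expr2; move: (q ^+ 2) => Q; clear; lra.
  have : d%:R * q ^+ 2 * (2 / 5 + 5 / 24 * d%:R) =
     2 / 5 * (d%:R * q ^+ 2) + 5 / 24 * d%:R * (d%:R * q ^+ 2) by ring.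
  have X0 : 0 <= d%:R * q ^+ 2 by rewrite mulr_ge0 ?sqr_ge0// ltW.
  move: s_le X0; set X := d%:R * q ^+ 2; set Y := 5 / 24 * d%:R * X.
  by move: (X * _) => Z; clear; lra.
apply: (@le_trans _ _ (282 / 100 * (q ^+ 2 * (77 / 180 / d%:R + 5 / 24)))).
  by apply: ler_pM => //; rewrite divr_ge0// sqr_ge0.
by rewrite mulrCA [leRHS]mulrC ler_wpM2l// sqr_ge0.
Qed.

Lemma mean_fid_moderate (R : realType) (d s : nat) (mu : probability (UdM R d) R) (q : R) :
  is_haar mu -> 0 < q -> 36 * d%:R <= q ^+ 2 ->
  s%:R <= d%:R * q ^+ 2 * (2 / 5 + 5 / 24 * d%:R) ->
  (2 <= d)%N -> (d = 2)%N \/ q <= 1200 * d%:R ^+ 3 ->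
  1 <= 32 * 4 ^+ (d * d) * q ^+ (d * (2 * d - 1)) * mean mu (fun U => fid U ^+ s).
Proof.
move=> haar q_gt0 q_ge s_le d2 hd; have d0 : (0 < d)%N by exact: ltnW.
have := mean_fid_ge_binomial haar d0 s; rewrite -div1r ler_pdivrMr; last first.
  by rewrite ltr0n bin_gt0 leq_addr.
move=> /le_trans; apply; rewrite mulrC; apply: ler_wpM2r; first exact: mean_fid_ge0.
have q0 := ltW q_gt0.
case: (ltngtP d 2) d2 => // [d3|d2] _; last first.
  (* For [d = 2] the powers of [q] agree: [2 (d^2 - 1) = d (2 d - 1) = 6]. *)
  apply: (@le_trans _ _ (282 / 100 * (12 / 10 * q ^+ 2) ^+ (d * d).-1)).
    by apply: (binomial_dim_le q_ge s_le); rewrite ?d2//; clear; lra.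
  rewrite d2 -[(2 * 2).-1]/3%N -[(2 * 2)%N]/4%N -[(2 * (4 - 1))%N]/6%N.
  rewrite exprMn -exprM -[(2 * 3)%N]/6%N mulrA.
  by apply: ler_wpM2r; [exact: exprn_ge0|clear; lra].
have {}hd : q <= 1200 * d%:R ^+ 3 by case: hd => // d2; move: d3; rewrite d2.
have DR : 3 <= d%:R :> R by rewrite ler_nat.
(* From [d = 3] on [c = 1] is admissible, so no constant is raised to the power [n]. *)
apply: (@le_trans _ _ (282 / 100 * (1 * q ^+ 2) ^+ (d * d).-1)).
  apply: (binomial_dim_le q_ge s_le (ltnW d3) ler01).
  have : d%:R^-1 <= 3^-1 :> R by rewrite lef_pV2 ?posrE//; apply: lt_le_trans DR.
  by move: (d%:R^-1) => x; clear; lra.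
rewrite mul1r -exprM (_ : 2 * (d * d).-1 = (d - 2) + d * (2 * d - 1))%N; last by clear -d3; nia.
rewrite exprD mulrA; apply: ler_wpM2r; first exact: exprn_ge0.
apply: le_trans (moderate_range_numeric R d3); apply: ler_wpM2l; first by clear; lra.
apply: lerXn2r; rewrite ?nnegrE; [exact: q0|exact: (le_trans q0 hd)|exact: hd].
Qed.

Lemma mean_fid_large (R : realType) (d s : nat) (mu : probability (UdM R d) R) (q : R) :
  is_haar mu -> 0 < q -> 36 * d%:R <= q ^+ 2 ->
  s%:R <= d%:R * q ^+ 2 * (2 / 5 + 5 / 24 * d%:R) ->
  (3 <= d)%N -> 1200 * d%:R ^+ 3 <= q ->
  1 <= 32 * 4 ^+ (d * d) * q ^+ (d * (2 * d - 1)) * mean mu (fun U => fid U ^+ s).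
Proof.
move=> haar q_gt0 q_ge s_le d3 qd; have d0 : (0 < d)%N by apply: leq_trans d3.
set D : R := d%:R; have D3 : 3 <= D by rewrite ler_nat.
have D0 : 0 < D by apply: lt_le_trans D3.
have q0 := ltW q_gt0.
pose r := Num.sqrt D; have r2 : r ^+ 2 = D by rewrite sqr_sqrtr// ltW.
have r1 : 1 <= r by rewrite -sqrtr1 ler_sqrt; clear -D3; lra.
have r0 : 0 < r by clear -r1; lra.
have qbig : 400 <= q.
  have : 27 <= D ^+ 3 by have -> : 27 = 3 ^+ 3 :> R; [ring|apply: lerXn2r; rewrite ?nnegrE//; lra].
  by move: qd; rewrite -/D; move: (D ^+ 3) => X; clear; lra.
have rq : 400 <= r * q by clear -r1 qbig; nra.
(* With [m] about [sqrt d * q / 2], [a = d / (15 m^2)] is at most [4 / (15 q^2)], and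
   [(1 - a)^(2 s)] loses only [(4/5)^(d^2)]. *)
pose m := (Num.truncn (r * q / 2)).+1.
have rq0 : 0 <= r * q / 2 by rewrite divr_ge0// mulr_ge0// ltW.
have /andP[mle mgt] := truncn_itv rq0.
have mle2 : m%:R <= r * q / 2 + 1 by rewrite /m -natr1 lerD2r.
have mge : r * q / 2 <= m%:R by exact: ltW.
have mR : 0 < m%:R :> R by rewrite ltr0n.
have m2 : D * q ^+ 2 / 4 <= m%:R ^+ 2.
  have -> : D * q ^+ 2 / 4 = (r * q / 2) ^+ 2 by rewrite -r2; field.
  by apply: lerXn2r; rewrite ?nnegrE// ltW.
have Q1 : 100 <= q ^+ 2 by clear -qbig; nra.
have dm : D <= 15 * m%:R ^+ 2.
  have : D * 100 <= D * q ^+ 2 by rewrite ler_wpM2l// ltW.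
  move: m2 D0; move: (D * q ^+ 2) (m%:R ^+ 2) => x y; clear; lra.
pose a : R := D / (15 * m%:R ^+ 2).
have a0 : 0 <= a by rewrite divr_ge0 ?mulr_ge0 ?sqr_ge0// ltW.
have aq : a * q ^+ 2 <= 4 / 15.
  rewrite /a mulrAC ler_pdivrMr ?mulr_gt0 ?exprn_gt0//.
  by move: m2; move: (m%:R ^+ 2) (D * q ^+ 2) => x y; clear; lra.
have a18 : a <= 18^-1 by clear -aq Q1 a0; nra.
have := mean_fid_ge mu (a := a) s; set mB := mean mu (\1_(fid_ball a)).
rewrite a0 (le_trans a18); last by clear; lra.
move=> /(_ isT) hI.
have mB0 : 0 <= mB by apply: Rintegral_ge0 => U _; rewrite indicE; case: (_ \in _).
have pw : (4 / 5) ^+ (d * d) <= (1 - a) ^+ (2 * s).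
  apply: (@le_trans _ _ (expR (- (18 / 17 * a)) ^+ (2 * s))); last first.
    apply: lerXn2r; rewrite ?nnegrE ?expR_ge0 ?one_sub_ge_expR ?a0//.
    by rewrite subr_ge0 (le_trans a18)//; clear; lra.
  apply: (@le_trans _ _ (expR (- (1 / 5)) ^+ (d * d))).
    have e45 : 4 / 5 <= expR (- (1 / 5)) :> R.
      by apply: le_trans (expR_ge1Dx _); clear; lra.
    by apply: lerXn2r => //; rewrite nnegrE ?expR_ge0//; clear; lra.
  rewrite -!expRM_natl ler_expR !natrM -/D.
  have h1 : s%:R * a <= D * (2 / 5 + 5 / 24 * D) * (4 / 15).
    apply: (@le_trans _ _ (D * q ^+ 2 * (2 / 5 + 5 / 24 * D) * a)).
      by apply: ler_wpM2r; [exact: a0|exact: s_le].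
    have -> : D * q ^+ 2 * (2 / 5 + 5 / 24 * D) * a =
      D * (2 / 5 + 5 / 24 * D) * (a * q ^+ 2) by ring.
    by apply: ler_wpM2l; [clear -D3; nra|exact: aq].
  have : 3 * D <= D * D by rewrite ler_wpM2r// ltW.
  rewrite (_ : D * _ * (4 / 15) = 8 / 75 * D + 1 / 18 * (D * D)) in h1; last first.
    by clear; field.
  have -> : 2 * s%:R * - (18 / 17 * a) = - (36 / 17 * (s%:R * a)) by ring.
  by move: (s%:R * a) (D * D) h1 => sa DD; clear -D0; lra.
have I0 := mean_fid_ge0 mu s; move: hI I0.
move: (\int[mu]_x (fid x ^+ s))%R => I hI I0.
pose A := 2 * (6 * D + 1); pose B := 2 * (m%:R + 1) : R; pose c := 5 / 4 : R.
have A0 : 0 <= A by rewrite mulr_ge0// addr_ge0// mulr_ge0// ltW.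
have B0 : 0 <= B by rewrite mulr_ge0// addr_ge0.
have c0 : 0 <= c by rewrite /c; clear; lra.
(* The cost per unit of the exponent [d^2]: [A] from covering the group, [B] from covering the
   neighbourhood of the identity, [c] from [(1 - a)^(2 s)]. *)
pose Y := A ^+ 2 * B * c.
have mBI : mB <= (5 / 4) ^+ (d * d) * I.
  have e1 : (5 / 4) ^+ (d * d) * (4 / 5) ^+ (d * d) = 1 :> R.
    by rewrite -exprMn (_ : 5 / 4 * (4 / 5) = 1) ?expr1n//; clear; field.
  rewrite -[leLHS]mul1r -[X in X * mB]e1 -[leLHS]mulrA.
  apply: ler_wpM2l; first by apply: exprn_ge0; clear; lra.
  by apply: le_trans hI; rewrite ler_wpM2r.
have YI : 1 <= Y ^+ (d * d) * I.
  apply: (le_trans (mean_near_identity_ge haar d0)).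
  have -> : Y ^+ (d * d) * I = A ^+ (d * d * 2) * (B ^+ (d * d) * (c ^+ (d * d) * I)).
    by rewrite /Y exprMn exprMn [(d * d * 2)%N]mulnC (exprM A) -!mulrA.
  apply: ler_wpM2l; first exact: exprn_ge0.
  apply: (le_trans (mean_near_identity_le haar d0 (ltn0Sn _) dm)).
  by apply: ler_wpM2l; [exact: exprn_ge0|exact: mBI].
have Y0 : 0 <= Y.
  by rewrite /Y mulr_ge0// mulr_ge0// sqr_ge0.
have YX : Y <= 4 * (51 * D ^+ 2 * r) * q.
  have h1 : (2 * (6 * D + 1)) ^+ 2 <= 161 * D ^+ 2 by clear -D3; nra.
  have h2 : 2 * (m%:R + 1) <= 101 / 100 * (r * q).
    by move: mle2 rq; move: (r * q) => x; clear; lra.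
  apply: (@le_trans _ _ (161 * D ^+ 2 * (101 / 100 * (r * q)) * (5 / 4))).
    rewrite /Y; apply: ler_wpM2r; first exact: c0.
    by apply: ler_pM; [exact: sqr_ge0|exact: B0|exact: h1|exact: h2].
  have -> : 161 * D ^+ 2 * (101 / 100 * (r * q)) * (5 / 4) =
    (161 * 101 / 80) * (D ^+ 2 * (r * q)) by clear; field.
  have -> : 4 * (51 * D ^+ 2 * r) * q = 204 * (D ^+ 2 * (r * q)) by clear; ring.
  apply: ler_wpM2r; first by rewrite mulr_ge0 ?sqr_ge0// mulr_ge0// ltW.
  by clear; lra.
have X0 : 0 <= 51 * D ^+ 2 * r.
  by apply: mulr_ge0; [apply: mulr_ge0; [exact: ler0n|exact: sqr_ge0]|exact: ltW].
(* The spare power of [q] absorbs the dimension factor; squaring first removes the root [r]. *)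
have Xq : (51 * D ^+ 2 * r) ^+ d <= q ^+ (d - 1).
  rewrite -(@ler_pXn2r _ 2)// ?nnegrE ?exprn_ge0// -!exprM ![(_ * 2)%N]mulnC !exprM.
  have -> : (51 * D ^+ 2 * r) ^+ 2 = 2601 * D ^+ 5.
    by rewrite exprMn r2; ring.
  apply: (le_trans (large_range_numeric R d3)).
  have T0 : 0 <= 1200 * D ^+ 3 by apply: mulr_ge0; [exact: ler0n|exact/exprn_ge0/ltW].
  apply: lerXn2r; rewrite ?nnegrE; [exact: sqr_ge0|exact: sqr_ge0|].
  by apply: lerXn2r; rewrite ?nnegrE; [exact: T0|exact: q0|exact: qd].
apply: (le_trans YI); apply: ler_wpM2r; first exact: I0.
move: (51 * D ^+ 2 * r) X0 Xq YX => Z Z0 Zq YZ.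
apply: (@le_trans _ _ ((4 * Z * q) ^+ (d * d))).
  by apply: lerXn2r; rewrite ?nnegrE; [exact: Y0|exact: (le_trans Y0 YZ)|exact: YZ].
rewrite !exprMn [Z ^+ (d * d)]exprM.
have -> : (d * (2 * d - 1) = (d - 1) * d + d * d)%N by clear -d0; nia.
rewrite exprD mulrA; apply: ler_wpM2r; first exact: exprn_ge0.
have P0 : 0 <= 4 ^+ (d * d) :> R by exact: exprn_ge0.
apply: (@le_trans _ _ (4 ^+ (d * d) * q ^+ ((d - 1) * d))).
  apply: ler_wpM2l => //; rewrite exprM; apply: lerXn2r => //; rewrite nnegrE exprn_ge0//.
apply: ler_wpM2r; first exact: exprn_ge0.
by move: (4 ^+ _) P0 => x; clear; lra.
Qed.

Lemma mean_fid_lower (R : realType) (d s : nat) (mu : probability (UdM R d) R) (q : R) :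
  is_haar mu -> 0 < q -> 36 * d%:R <= q ^+ 2 ->
  s%:R <= d%:R * q ^+ 2 * (2 / 5 + 5 / 24 * d%:R) ->
  (2 <= d)%N ->
  1 <= 32 * 4 ^+ (d * d) * q ^+ (d * (2 * d - 1)) * mean mu (fun U => fid U ^+ s).
Proof.
move=> haar q_gt0 q_ge s_le d2; have [d3|d3] := leqP 3 d; last first.
  by apply: mean_fid_moderate => //; left; apply/eqP; rewrite eqn_leq d2 -ltnS d3.
have [h|/ltW h] := leP q (1200 * d%:R ^+ 3); last exact: mean_fid_large.
by apply: mean_fid_moderate => //; right.
Qed.

(** * Construction of the kernel *)

Section IntegralBounds.
Context {disp : measure_display} {T : measurableType disp} {R : realType}.
Variable mu : probability T R.

(** The comparison is made between the suprema over simple functions that define the integrals, so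
    it applies to an arbitrary set [A], such as the complement of a [chan_dist] ball. *)
Lemma integral_setD_le (A : set T) (f g : T -> R) :
  (forall x, A x -> 0 <= f x <= g x) -> (forall x, 0 <= g x) ->
  (\int[mu]_(x in A) (f x)%:E <= \int[mu]_x (g x)%:E)%E.
Proof.
move=> fg g0.
have f0' x : A x -> (0 <= (f x)%:E)%E by move=> Ax; rewrite lee_fin; have /andP[] := fg _ Ax.
have g0' x : [set: T] x -> (0 <= (g x)%:E)%E by rewrite lee_fin.
rewrite (ge0_integralE _ f0') (ge0_integralE _ g0').
apply: ereal_sup_le => _ [h hf <-]; exists h => // x; apply: le_trans (hf x) _.
rewrite !patchE in_setT; case: ifPn => [/set_mem Ax|_]; rewrite lee_fin//.
by have /andP[] := fg _ Ax.
Qed.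

Lemma Lnorm2_le (f : T -> R) (B : R) : bmeas f -> 0 <= B ->
  (\int[mu]_x (f x ^+ 2))%R <= B ^+ 2 -> ('N[mu]_2%:E [EFin \o f] <= B%:E)%E.
Proof.
move=> bf B0 fB; rewrite unlock /=.
under eq_integral => x _.
  rewrite -[(2 : R)]/(2%:R) powR_mulrn// real_normK ?num_real//.
  over.
rewrite /= EFin_mean; last exact: bmeasX.
rewrite poweR_EFin lee_fin powR12_sqrt; last by apply: Rintegral_ge0 => x _; exact: sqr_ge0.
by rewrite -(ger0_norm B0) -sqrtr_sqr ler_sqrt// sqr_ge0.
Qed.

End IntegralBounds.

Lemma measurable_in_H (R : realType) d n (f : Ud R d -> R) : in_H n f ->
  measurable_fun setT (f : UdM R d -> R).
Proof.
move=> [ts [_ fE]].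
have cm : cmeas (fun U : UdM R d => \sum_(x <- ts) bterm_eval x (val U)).
  apply: cmeas_sum => x; apply: cmeasM.
    apply: cmeasM; first exact: cmeas_cst.
    by apply: cmeas_prod => a; exact: cmeas_entry.
  by apply: cmeas_prod => a; apply: cmeas_conjc; exact: cmeas_entry.
rewrite (_ : f = fun U => complex.Re (\sum_(x <- ts) bterm_eval x (val U))).
  exact: cm.1.
by apply/funext => U; rewrite -fE.
Qed.

(** Here [q] stands for [1 / sigma], in the range where (2) has content. Concentration is expressed
    by a majorant [g] on the whole group, with a small mean. *)
Lemma concentrated_polynomial (R : realType) (d : nat) (mu : probability (UdM R d) R)
    (eps q : R) (k : nat) :
  is_haar mu -> (2 <= d)%N -> 0 < eps -> eps <= 1 -> 0 < q ->
  36 * d%:R <= eps ^+ 2 * q ^+ 2 -> d%:R ^+ 2 <= eps ^+ 2 * q ^+ 2 ->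
  25 * d%:R ^+ 3 * q ^+ 2 * (eps ^+ 2 * q ^+ 2 / (8 * d%:R ^+ 2) + ln q) <= k%:R ^+ 2 ->
  exists F : Ud R d -> R, [/\ phase_invariant F,
    bmeas (F : UdM R d -> R) /\ (forall U, 0 <= F U),
    mean mu F = 1, in_H k F &
    (exists g : UdM R d -> R, [/\ bmeas g, forall U, 0 <= g U,
      mean mu g <= 9 * expR (- (eps ^+ 2 * q ^+ 2 / 4)) &
      forall U, Num.sqrt (fid U) <= 1 - eps ^+ 2 / (2 * d%:R) -> F U <= g U]) /\
    mean mu (fun U => F U ^+ 2) <= 64 * 4 ^+ (d * d) * q ^+ (d * (2 * d - 1))].
Proof.
move=> haar d2 eps0 eps1 q0 E36 ED kK.
set E := eps ^+ 2 * q ^+ 2 in E36 ED kK *.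
set D : R := d%:R in E36 ED kK *.
have d0 : (0 < d)%N by exact: ltnW.
have D2 : 2 <= D by rewrite ler_nat.
have D0 : 0 < D by apply: lt_le_trans D2.
have e0 : 0 < eps ^+ 2 by rewrite exprn_gt0.
have e1 : eps ^+ 2 <= 1 by rewrite -[leRHS](expr1n _ 2); apply: lerXn2r; rewrite ?nnegrE// ltW.
have Q0 : 0 < q ^+ 2 by rewrite exprn_gt0.
have EQ : E <= q ^+ 2 by rewrite /E -[leRHS]mul1r ler_wpM2r// ltW.
have Q36 : 36 * D <= q ^+ 2 by apply: le_trans EQ.
(* [E >= 36 d] bounds [t] by [d^2 q^2 / 36], for the estimate of [J]; [E >= d^2] bounds it by
   [d q^2], for the truncation error. *)
pose t : R := D ^+ 3 / eps ^+ 2.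
have te : t * eps ^+ 2 = D ^+ 3 by rewrite /t divfK// gt_eqF.
have t0 : 0 <= t by rewrite divr_ge0 ?exprn_ge0 ?ltW.
have tE : t * E = D ^+ 3 * q ^+ 2 by rewrite /E mulrA te.
have t36 : 36 * t <= D ^+ 2 * q ^+ 2.
  rewrite -(ler_pM2l D0); have := ler_wpM2l t0 E36; rewrite tE.
  have -> : D ^+ 3 * q ^+ 2 = D * (D ^+ 2 * q ^+ 2) by clear; ring.
  by have -> : t * (36 * D) = D * (36 * t) by clear; ring.
have tD : t <= D * q ^+ 2.
  rewrite -(ler_pM2l (exprn_gt0 2 D0)); have := ler_wpM2l t0 ED; rewrite tE.
  have -> : D ^+ 3 * q ^+ 2 = D ^+ 2 * (D * q ^+ 2) by clear; ring.
  by rewrite mulrC.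
(* [2 v eps^2 / D = E / 4 + 5 D^2]: the decay of [fid ^ (2 u)] outside the ball must
   absorb both the target [exp (- E / 4)] and the loss in [mean_fid_doubling]. *)
pose v : R := D * q ^+ 2 / 8 + 5 / 2 * t.
have v0 : 0 <= v.
  rewrite /v; apply: addr_ge0; first by rewrite divr_ge0// mulr_ge0// ltW.
  by apply: mulr_ge0 => //; clear; lra.
pose u := (Num.truncn v).+1.
have /andP[ule ugt] := truncn_itv v0.
have uv1 : u%:R <= v + 1 by rewrite /u -natr1 lerD2r.
have vu : v <= u%:R by exact: ltW.
(* Outside the ball [fid ^ (2 u)] is small pointwise; the remaining [fid ^ u] is integrated by the
   doubling estimate. *)
pose s := (3 * u)%N.
have DQ : 36 * D ^+ 2 <= D * q ^+ 2.
  have := ler_wpM2l (ltW D0) Q36.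
  by have -> : D * (36 * D) = 36 * D ^+ 2 by clear; ring.
have DD : 4 <= D ^+ 2 by clear -D2; nra.
have sE : s%:R = 3 * u%:R :> R by rewrite natrM.
have s_le1 : s%:R <= D * q ^+ 2 * (2 / 5 + 5 / 24 * D).
  have -> : D * q ^+ 2 * (2 / 5 + 5 / 24 * D) =
    2 / 5 * (D * q ^+ 2) + 5 / 24 * (D ^+ 2 * q ^+ 2) by clear; ring.
  rewrite sE; move: uv1 DQ t36 DD; rewrite /v.
  move: (D * q ^+ 2) (D ^+ 2 * q ^+ 2) (D ^+ 2) => x y z; clear; lra.
have s_le2 : s%:R <= 79 / 10 * (D * q ^+ 2).
  rewrite sE; move: uv1 DQ tD DD; rewrite /v.
  move: (D * q ^+ 2) (D ^+ 2) => x z; clear; lra.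
have u_ge : 9 * D ^+ 2 <= 2 * u%:R.
  move: vu DQ t0; rewrite /v; move: (D * q ^+ 2) (D ^+ 2) => x z; clear; lra.
have expo : E / 4 + 5 * D ^+ 2 <= 2 * u%:R * (eps ^+ 2 / D).
  apply: (@le_trans _ _ (2 * v * (eps ^+ 2 / D))); last first.
    apply: ler_wpM2r; first by rewrite divr_ge0// ltW.
    by apply: ler_wpM2l.
  rewrite le_eqVlt; apply/orP; left; apply/eqP.
  by rewrite /v /t /E; field; rewrite !gt_eqF.
have s0 : (0 < s)%N by rewrite /s muln_gt0.
have sR : 0 < s%:R :> R by rewrite ltr0n.
pose J := mean mu (fun U => fid U ^+ s).
have J_ge := mean_fid_lower haar q0 Q36 s_le1 d2; rewrite -/J in J_ge.
have P40 : 0 <= 4 ^+ (d * d) :> R by exact: exprn_ge0.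
have qe0 : 0 < q ^+ (d * (2 * d - 1)) by rewrite exprn_gt0.
have J0 : 0 < J.
  have : 0 <= J by exact: mean_fid_ge0.
  rewrite le_eqVlt => /predU1P[J0|//].
  by move: J_ge; rewrite -J0 mulr0 ler10.
have bfid n : bmeas (fun U : UdM R d => fid U ^+ n) by exact/bmeasX/bmeas_fid.
have J1 : J <= 1.
  rewrite -(mean_cst mu 1); apply: le_mean => //; first exact: bmeas_cst.
  by move=> U; apply: exprn_ile1; rewrite ?fid_ge0 ?fid_le1.
have q8 : 8 <= q.
  rewrite -(@ler_pXn2r _ 2)// ?nnegrE ?ltW//.
  by move: Q36 D2; move: (q ^+ 2) => x; clear; lra.
have L0 : 0 <= ln q by apply: ln_ge0; apply: le_trans q8; clear; lra.
pose delta : R := expR (- (k%:R ^+ 2 / s%:R)).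
have delta0 : 0 <= delta by exact: expR_ge0.
(* The degree hypothesis is divided by [s <= 79/10 d q^2]: [79/40 <= 25/8] covers the term in [E],
   and [237/10 <= 25] the term in [ln q]. *)
have delta_le1 : delta <= expR (- (E / 4)) * (q ^+ (3 * (d * d)))^-1.
  have -> : (q ^+ (3 * (d * d)))^-1 = expR (- (3 * D ^+ 2 * ln q)).
    rewrite expRN; congr (_^-1); rewrite -[in LHS](lnK (x := q)) ?posrE// -expRM_natl.
    by congr expR; rewrite !natrM; clear; ring.
  rewrite -expRD ler_expR -opprD lerN2 ler_pdivlMr//.
  apply: le_trans kK.
  apply: (@le_trans _ _ ((E / 4 + 3 * D ^+ 2 * ln q) * (79 / 10 * (D * q ^+ 2)))).
    apply: ler_wpM2l => //; apply: addr_ge0.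
      by rewrite divr_ge0// mulr_ge0// ltW.
    by rewrite mulr_ge0// mulr_ge0// sqr_ge0.
  have -> : (E / 4 + 3 * D ^+ 2 * ln q) * (79 / 10 * (D * q ^+ 2)) =
    79 / 40 * (D * q ^+ 2 * E) + 237 / 10 * (D ^+ 3 * q ^+ 2 * ln q) by clear; field.
  have -> : 25 * D ^+ 3 * q ^+ 2 * (E / (8 * D ^+ 2) + ln q) =
    25 / 8 * (D * q ^+ 2 * E) + 25 * (D ^+ 3 * q ^+ 2 * ln q).
    by clear -D0; field; rewrite gt_eqF.
  have x0 : 0 <= D * q ^+ 2 * E by rewrite mulr_ge0 ?mulr_ge0 ?ltW// mulr_gt0.
  have y0 : 0 <= D ^+ 3 * q ^+ 2 * ln q by apply: mulr_ge0 => //; apply: mulr_ge0; apply: exprn_ge0; exact: ltW.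
  by move: x0 y0; move: (D * q ^+ 2 * E) (D ^+ 3 * q ^+ 2 * ln q) => x y; clear; lra.
(* The lower bound on [J] loses [q^(d (2 d - 1))]; the remaining [q^(d + d^2)] beats [16 * 4^(d^2)]
   because [q >= 8]. *)
have delta_le : delta <= 2 * expR (- (E / 4)) * J.
  apply: (le_trans delta_le1); rewrite (mulrC 2) -(mulrA _ 2 J); apply: ler_wpM2l; first exact: expR_ge0.
  have -> : (3 * (d * d) = d * (2 * d - 1) + (d + d * d))%N by clear -d2; nia.
  rewrite exprD -[leLHS]mul1r ler_pdivrMr ?mulr_gt0 ?exprn_gt0//.
  have h16 : 16 * 4 ^+ (d * d) <= q ^+ (d + d * d).
    apply: (@le_trans _ _ (8 ^+ (d * d))).
      have -> : 8 ^+ (d * d) = 2 ^+ (d * d) * 4 ^+ (d * d) :> R.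
        by rewrite -exprMn; congr (_ ^+ _); clear; ring.
      apply: ler_wpM2r => //; apply: (@le_trans _ _ (2 ^+ 4)); first by clear; lra.
      apply: ler_weXn2l; first by clear; lra.
      by rewrite (leq_trans _ (leq_mul d2 d2)).
    apply: (@le_trans _ _ (q ^+ (d * d))); first by apply: lerXn2r; rewrite ?nnegrE// ltW.
    apply: ler_weXn2l; first by apply: le_trans q8; clear; lra.
    exact: leq_addl.
  apply: (le_trans J_ge); rewrite (mulrAC 2); apply: ler_wpM2r; first exact: ltW.
  have := ler_wpM2r (ltW qe0) h16.
  by move: (4 ^+ _) (q ^+ _) (q ^+ _) => x y z; clear; lra.
have delta1 : 4 * delta <= 1.
  have : expR (- (E / 4)) <= 1 / 19.
    have : expR (E / 4) * expR (- (E / 4)) = 1 by rewrite -expRD subrr expR0.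
    have := expR_ge1Dx (E / 4); have : 0 < expR (- (E / 4)) by exact: expR_gt0.
    by move: E36 D2; move: (expR (E / 4)) (expR (- (E / 4))) => a b; clear; nra.
  have : 0 < expR (- (E / 4)) by exact: expR_gt0.
  have aux (b j z : R) : z <= 2 * b * j -> 0 < j -> j <= 1 -> 0 < b -> b <= 1 / 19 -> 4 * z <= 1.
    by clear; nra.
  exact: aux delta_le J0 J1.
(* The truncation error is at most [2 delta], so this shift gives [G >= fid ^ s >= 0]: absolute
   values disappear and the normalisation is at least [J]. *)
pose G (U : UdM R d) : R := trunc_pow s k (fid U) + 2 * delta.
have fid01 (U : UdM R d) : 0 <= fid U <= 1 by rewrite fid_ge0 fid_le1.
have GP U : fid U ^+ s <= G U <= fid U ^+ s + 4 * delta.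
  have := trunc_pow_dist k s0 (fid01 U); rewrite -/delta /G ler_norml.
  by move: (trunc_pow _ _ _) (fid U ^+ s) => x y; clear; lra.
have G0 U : 0 <= G U.
  by apply: le_trans (_ : fid U ^+ s <= _); [rewrite exprn_ge0 ?fid_ge0|have /andP[] := GP U].
have inG : in_H k (G : Ud R d -> R) by apply: in_HD; [exact: in_H_trunc_pow|exact: in_H_cst].
have mG : measurable_fun setT G := measurable_in_H inG.
have bG : bmeas G.
  split => //; exists 2 => U; rewrite ger0_norm//.
  have /andP[_ h] := GP U; apply: (le_trans h).
  have : fid U ^+ s <= 1 by apply: exprn_ile1; rewrite ?fid_ge0 ?fid_le1.
  by move: delta1; move: (fid U ^+ s) => x; clear; lra.
pose c := mean mu G.
have Jc : J <= c by apply: le_mean => // U; have /andP[] := GP U.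
have c0 : 0 < c by apply: lt_le_trans Jc.
exists (fun U => c^-1 * G U); split.
- exact: (phase_invariant_fid (fun x => c^-1 * (trunc_pow s k x + 2 * delta))).
- by split=> [|U]; [exact: bmeasZ|rewrite mulr_ge0// invr_ge0 ltW].
- by rewrite meanZ// mulVf// gt_eqF.
- exact: in_HZ.
split.
  pose g (U : UdM R d) := c^-1 * (expR (- (E / 4 + 5 * D ^+ 2)) * fid U ^+ u + 4 * delta).
  have bg : bmeas g.
    by apply: bmeasZ; apply: bmeasD; [exact: bmeasZ|exact: bmeas_cst].
  exists g; split => //.
  - move=> U; apply: mulr_ge0; first by rewrite invr_ge0 ltW.
    apply: addr_ge0; last by apply: mulr_ge0.
    by apply: mulr_ge0; [exact: expR_ge0|rewrite exprn_ge0 ?fid_ge0].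
  - rewrite /g meanZ; last by apply: bmeasD; [exact: bmeasZ|exact: bmeas_cst].
    rewrite meanD; [|exact: bmeasZ|exact: bmeas_cst].
    rewrite meanZ// mean_cst.
    have h1 : expR (- (E / 4 + 5 * D ^+ 2)) * mean mu (fun U => fid U ^+ u) <= expR (- (E / 4)) * J.
      have := mean_fid_doubling haar d0 u_ge; rewrite -/s -/J => h.
      apply: (@le_trans _ _ (expR (- (E / 4 + 5 * D ^+ 2)) * (expR (5 * D ^+ 2) * J))).
        by apply: ler_wpM2l; [exact: expR_ge0|exact: h].
      by rewrite mulrA -expRD opprD addrNK.
    (* The constant is [9 = 1 + 8]: the main term gives [exp (- E / 4) J], and [4 delta] at most 8
       times that. *)
    rewrite ler_pdivrMl//; have : 0 <= expR (- (E / 4)) by exact: expR_ge0.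
    have aux (x y z w v' : R) : x <= y * z -> v' <= 2 * y * z -> z <= w -> 0 <= y ->
        x + 4 * v' <= w * (9 * y).
      by clear; nra.
    exact: aux h1 delta_le Jc.
  - move=> U hU; rewrite /g; apply: ler_wpM2l; first by rewrite invr_ge0 ltW.
    have /andP[_ h] := GP U; apply: (le_trans h); rewrite lerD2r.
    rewrite /s mulSn exprD mulrC; apply: ler_wpM2r; first by rewrite exprn_ge0 ?fid_ge0.
    set w := Num.sqrt (fid U) in hU; have w0 : 0 <= w by exact: sqrtr_ge0.
    have -> : fid U = w ^+ 2 by rewrite sqr_sqrtr ?fid_ge0.
    rewrite -exprM.
    apply: (@le_trans _ _ (expR (- (eps ^+ 2 / (2 * D))) ^+ (2 * (2 * u)))).
      apply: lerXn2r; rewrite ?nnegrE ?expR_ge0//.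
      by apply: (le_trans hU); apply: expR_ge1Dx.
    rewrite -expRM_natl ler_expR mulrN lerN2; apply: (le_trans expo).
    rewrite le_eqVlt; apply/orP; left; apply/eqP; rewrite !natrM.
    by clear -D0; field; rewrite gt_eqF.
(* As [G <= 2], the square of the kernel is at most [2 / c] times the kernel, whose mean is 1. *)
apply: (@le_trans _ _ (mean mu (fun U => (2 * c^-1) * (c^-1 * G U)))).
  apply: le_mean; [exact/bmeasX/bmeasZ|exact/bmeasZ/bmeasZ|].
  move=> U; rewrite expr2 [2 * _]mulrC; apply: ler_wpM2r.
    by rewrite mulr_ge0// invr_ge0 ltW.
  apply: ler_wpM2l; first by rewrite invr_ge0 ltW.
  have /andP[_ h] := GP U; apply: (le_trans h).
  have : fid U ^+ s <= 1 by apply: exprn_ile1; rewrite ?fid_ge0 ?fid_le1.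
  by move: delta1; move: (fid U ^+ s) => x; clear; lra.
rewrite meanZ; last exact: bmeasZ.
rewrite meanZ// mulVf ?gt_eqF// mulr1 -/c ler_pdivrMr//.
apply: (@le_trans _ _ (2 * (32 * 4 ^+ (d * d) * q ^+ (d * (2 * d - 1)) * J))).
  by rewrite -[leLHS]mulr1; apply: ler_wpM2l.
have -> : 2 * (32 * 4 ^+ (d * d) * q ^+ (d * (2 * d - 1)) * J) =
  64 * 4 ^+ (d * d) * q ^+ (d * (2 * d - 1)) * J by clear; ring.
by apply: ler_wpM2l => //; rewrite mulr_ge0 ?mulr_ge0// ltW.
Qed.

Lemma sqr_L2_bound (R : realType) (d : nat) (sigma : R) : (0 < d)%N -> 0 < sigma ->
  (8 * 2 ^+ (d * d) * sigma `^ (- (d%:R * (d%:R - 2^-1)))) ^+ 2 =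
  64 * 4 ^+ (d * d) * sigma^-1 ^+ (d * (2 * d - 1)).
Proof.
move=> d0 s0; rewrite !exprMn -!exprM (mulnC _ 2%N) exprM; congr (_ * _ ^+ _ * _).
- by clear; ring.
- by clear; ring.
rewrite -powR_mulrn ?powR_ge0// -powRrM.
have -> : - (d%:R * (d%:R - 2^-1)) * 2 = - (d * (2 * d - 1))%:R :> R.
  by rewrite natrM natrB ?muln_gt0// natrM; field.
by rewrite powRN powR_mulrn ?ltW// exprVn.
Qed.

Theorem theorem1 (R : realType) (d : nat) (eps sigma : R)
  (mu : probability (UdM R d) R) :
  is_haar mu ->
  (2 <= d)%N ->
  0 < eps -> eps <= 1 ->
  0 < sigma -> sigma <= eps / (6 * Num.sqrt (d%:R)) ->
  forall k : nat, (0 < k)%N ->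
  exists F : UdM R d -> R,
    phase_invariant F /\
    (* (1) normalisation *)
    (\int[mu]_U (F U)%:E = 1)%E /\
    (* (2) concentration outside the ball B(I, eps) *)
    (k%:R >= 5 * (d%:R `^ (3 / 2)) / sigma
              * Num.sqrt (eps ^+ 2 / (8 * d%:R ^+ 2 * sigma ^+ 2) + ln (sigma^-1)) ->
     (\int[mu]_(U in ~` [set U : UdM R d | (chan_dist (val U) 1%:M <= eps)%R])
         (`|F U|)%:E
      <= (9 * expR (- (eps ^+ 2 / (4 * sigma ^+ 2))) * (pi / 2) ^+ (d * (d - 1)))%:E)%E) /\
    (* (3) balanced polynomial of degree k *)
    in_H k F /\
    (* (4) L2-norm bound *)
    (d%:R / sigma <= k%:R ->
     ('N[mu]_(2%:E) [(fun U => (F U)%:E)]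
      <= (8 * 2 ^+ (d * d) * sigma `^ (- (d%:R * (d%:R - 2^-1))))%:E)%E).
Proof.
move=> haar d2 eps0 eps1 s0 s_le k k0.
have d0 : (0 < d)%N by exact: ltnW.
pose q := sigma^-1; have q0 : 0 < q by rewrite invr_gt0.
have D0 : 0 < d%:R :> R by rewrite ltr0n.
pose E := eps ^+ 2 * q ^+ 2.
have E4 : eps ^+ 2 / (4 * sigma ^+ 2) = E / 4.
  by rewrite /E /q; clear -s0; field; rewrite gt_eqF.
have E36 : 36 * d%:R <= E.
  have w0 : 0 < 6 * Num.sqrt d%:R :> R by rewrite mulr_gt0// sqrtr_gt0.
  have : 6 * Num.sqrt d%:R <= eps * q.
    by rewrite /q ler_pdivlMr// -ler_pdivlMl// mulrC.
  have -> : E = (eps * q) ^+ 2 by rewrite exprMn.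
  have -> : 36 * d%:R = (6 * Num.sqrt d%:R) ^+ 2 :> R.
    by rewrite exprMn sqr_sqrtr ?ler0n//; clear; ring.
  by move=> h; apply: lerXn2r; rewrite ?nnegrE// mulr_ge0 ?ltW.
set K := 5 * _ / _ * _; set B2 := 9 * _ * _; set B4 := 8 * _ * _.
have B40 : 0 <= B4 by apply: mulr_ge0; [apply: mulr_ge0 => //|exact: powR_ge0].
have B4sq : B4 ^+ 2 = 64 * 4 ^+ (d * d) * q ^+ (d * (2 * d - 1)) by exact: sqr_L2_bound.
have q1 : 1 <= q.
  have : 1 <= q ^+ 2.
    have : E <= q ^+ 2.
      rewrite /E -[leRHS]mul1r; apply: ler_wpM2r; first exact: sqr_ge0.
      by rewrite -[leRHS](expr1n _ 2); apply: lerXn2r; rewrite ?nnegrE// ltW.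
    apply: le_trans; apply: le_trans E36.
    have : 1 <= d%:R :> R by rewrite ler1n.
    by move: (d%:R : R) => x; clear; lra.
  by rewrite -[leLHS](expr1n _ 2) ler_pXn2r// ?nnegrE// ltW.
have [/andP[Kk B2_lt1]|trivial_case] := boolP ((K <= k%:R) && (B2 < 1)); last first.
  exists (fun=> 1); split; first by [].
  have mean1 : (\int[mu]_U (1 : R)%:E = 1)%E.
    by rewrite EFin_mean ?mean_cst//; exact: bmeas_cst.
  split; first exact: mean1.
  split.
    move=> Kk; move: trivial_case; rewrite Kk /= -leNgt => B2_ge1.
    apply: (@le_trans _ _ (\int[mu]_U (1 : R)%:E)%E); last by rewrite mean1 lee_fin.
    by apply: (@integral_setD_le _ _ _ mu _ (fun=> `|1|) (fun=> 1)) => [U _|_]; rewrite ?normr1 ?ler01 ?lexx.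
  split; first exact: in_H_cst.
  move=> _; apply: Lnorm2_le => //; first exact: bmeas_cst.
  rewrite expr1n mean_cst B4sq.
  apply: mulr_ege1; last exact: exprn_ege1.
  by apply: mulr_ege1; [|apply: exprn_ege1]; clear; lra.
have ED : d%:R ^+ 2 <= E.
  by apply: sqr_le_of_trivial_bound_fails => //; move: B2_lt1; rewrite /B2 E4.
have ln0 : 0 <= ln q by exact: ln_ge0.
(* This is the square of the inequality [K <= k]. *)
have kK : 25 * d%:R ^+ 3 * q ^+ 2 * (E / (8 * d%:R ^+ 2) + ln q) <= k%:R ^+ 2.
  have arg : eps ^+ 2 / (8 * d%:R ^+ 2 * sigma ^+ 2) + ln sigma^-1 = E / (8 * d%:R ^+ 2) + ln q.
    by congr (_ + _); rewrite /E /q; clear -s0 D0; field; rewrite !gt_eqF.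
  have arg0 : 0 <= E / (8 * d%:R ^+ 2) + ln q.
    by rewrite addr_ge0// divr_ge0// mulr_ge0// sqr_ge0.
  have -> : 25 * d%:R ^+ 3 * q ^+ 2 * (E / (8 * d%:R ^+ 2) + ln q) = K ^+ 2.
    have pow3 : (d%:R `^ (3 / 2)) ^+ 2 = d%:R ^+ 3 :> R.
      rewrite -(powR_mulrn 2 (powR_ge0 _ _)) -powRrM.
      have -> : 3 / 2 * 2%:R = 3%:R :> R by clear; field.
      by rewrite powR_mulrn ?ler0n.
    rewrite /K arg !exprMn sqr_sqrtr// -/q pow3; congr (_ * _ * _ * _).
    by clear; ring.
  apply: lerXn2r; rewrite ?nnegrE//.
  by rewrite /K !mulr_ge0 ?powR_ge0 ?invr_ge0 ?sqrtr_ge0// ltW.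
have [F [phaseF [bF F0] F1 HF [[g [bg g0 mean_g Fg]] meanF2]]] :=
  concentrated_polynomial haar d2 eps0 eps1 q0 E36 ED kK.
exists F; split; first exact: phaseF.
split; first by rewrite EFin_mean// F1.
split; last first.
  split; first exact: HF.
  by move=> _; apply: Lnorm2_le => //; rewrite B4sq.
move=> _; apply: (@le_trans _ _ (\int[mu]_U (g U)%:E)%E).
  apply: integral_setD_le => // U /= /negP; rewrite -ltNge => far.
  rewrite normr_ge0 ger0_norm// Fg//.
  have := lt_le_trans far (chan_dist_fid U d0).
  (* Squaring [eps < sqrt (2 d (1 - sqrt (fid U)))] gives the condition under which [g] dominates
     [F]. *)
  rewrite -[X in X < _](ger0_norm (ltW eps0)) -[X in X < _]sqrtr_sqr.
  move=> /ltW; rewrite ler_sqrt; last first.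
    rewrite mulr_ge0 ?mulr_ge0 ?ler0n// subr_ge0 -[leRHS]sqrtr1 ler_sqrt//.
    exact: fid_le1.
  rewrite mulrC -ler_pdivrMr ?mulr_gt0//.
  by move: (_ / _) (Num.sqrt _) => x y; clear; lra.
rewrite EFin_mean// lee_fin; apply: (le_trans mean_g); rewrite /B2 E4.
(* The kernel satisfies the bound without the power of [pi / 2], which is at least 1. *)
rewrite -[leLHS]mulr1; apply: ler_wpM2l; first by rewrite mulr_ge0 ?expR_ge0.
by apply: exprn_ege1; have := pihalf_ge R; move: (pi / 2) => x; clear; lra.
Qed.
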